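(* In every instance of fair division with market values (with additive subjective utilities and additive market valuation), there exists an allocation that is EF1 with respect to the subjective utilities and SD-EF1 with respect to the market valuation, and such an allocation can be computed in polynomial time.
   Context: An instance of fair division with market values $\langle \mathcal{N}, \mathcal{M}, v, (u_i)_{i\in\mathcal{N}}\rangle$ consists of a finite set $\mathcal{N}$ of $n$ agents, a finite set $\mathcal{M}$ of $m$ indivisible goods, a market valuation $v:2^{\mathcal{M}}\to\mathbb{R}_{\ge 0}$, and a subjective utility function $u_i:2^{\mathcal{M}}\to\mathbb{R}_{\ge 0}$ for each agent $i$. Here all these set functions are additive: $f(S)=\sum_{g\in S} f(\{g\})$ for all $S\subseteq\mathcal{M}$, with $f(\emptyset)=0$; write $f(g)=f(\{g\})$. An allocation $A=(A_1,\dots,A_n)$ is a partition of $\mathcal{M}$ into $n$ pairwise disjoint (possibly empty) bundles, with $A_i$ given to agent $i$ and $\bigcup_i A_i=\mathcal{M}$. $A$ is EF1 (envy-free up to one good) with respect to the subjective utilities if for every $i,j\in\mathcal{N}$, either $A_j=\emptyset$ or $u_i(A_i)\ge u_i(A_j\setminus\{g\})$ for some $g\in A_j$. SD-preference under $v$: for $X,Y\subseteq\mathcal{M}$, write $X \succcurlyeq^{\mathsf{SD}}_{v} Y$ if for each good $g\in\mathcal{M}$, $|\{g'\in X: v(g')\ge v(g)\}|\ge |\{g'\in Y: v(g')\ge v(g)\}|$. $A$ is SD-EF1 with respect to the market valuation if for every $i,j\in\mathcal{N}$, either $A_j=\emptyset$ or $A_i\succcurlyeq^{\mathsf{SD}}_{v}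 A_j\setminus\{g\}$ for some $g\in A_j$. *)

(* Defs.v *)
From mathcomp Require Import all_boot all_order all_algebra.
From mathcomp Require Import reals.

Set Implicit Arguments.
Unset Strict Implicit.
Unset Printing Implicit Defensive.

Import Order.TTheory GRing.Theory Num.Theory.

Local Open Scope ring_scope.

Section FairDivision.
Variables (R : realType) (N M : finType).

(* Taking S = set0 gives f set0 = 0. *)
Definition additive_setfun (f : {set M} -> R) : Prop :=
  forall S : {set M}, f S = \sum_(g in S) f [set g].

Definition nonneg_setfun (f : {set M} -> R) : Prop :=
  forall S : {set M}, 0 <= f S.

Definition fair_division_instance
    (v : {set M} -> R) (u : N -> {set M} -> R) : Prop :=
  [/\ (0 < #|N|)%N,
      nonneg_setfun v /\ additive_setfun v
    & forall i, nonneg_setfun (u i) /\ additive_setfun (u i)].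

Definition is_allocation (A : {ffun N -> {set M}}) : Prop :=
  (forall i j, i != j -> [disjoint A i & A j]) /\
  \bigcup_(i : N) A i = [set: M].

Definition EF1 (u : N -> {set M} -> R) (A : {ffun N -> {set M}}) : Prop :=
  forall i j, A j = set0 \/
    exists2 g, g \in A j & u i (A j :\ g) <= u i (A i).

Definition SD_pref (v : {set M} -> R) (X Y : {set M}) : Prop :=
  forall g : M,
    (#|[set g' in Y | (v [set g] <= v [set g'])%R]| <=
     #|[set g' in X | (v [set g] <= v [set g'])%R]|)%N.

Definition SD_EF1 (v : {set M} -> R) (A : {ffun N -> {set M}}) : Prop :=
  forall i j, A j = set0 \/
    exists2 g, g \in A j & SD_pref v (A i) (A j :\ g).

End FairDivision.

(* Model of computation: while programs on a random access machine. The       *)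
(* memory consists of two-index arrays of natural numbers and two-index       *)
(* arrays of values, each array being named by a natural number fixed in the  *)
(* program text. Programs contain no value constant, and a single program     *)
(* handles all numbers of agents and goods.                                   *)
(*   The only arithmetic is addition and subtraction, so that t steps extend  *)
(* the binary length of the numbers in memory by O(t) bits. Hence, on         *)
(* rational inputs, a unit-cost running time polynomial in the number of      *)
(* input values is polynomial time on a Turing machine.                       *)

Inductive iexp : Type :=
| IConst of nat
| IGet of nat & iexp & iexp
| IAdd of iexp & iexp
| ISub of iexp & iexp.

Inductive vexp : Type :=
| VZero
| VGet of nat & iexp & iexp
| VAdd of vexp & vexp
| VSub of vexp & vexp.

Inductive bexp : Type :=
| BLeI of iexp & iexp
| BLeV of vexp & vexp
| BNot of bexp
| BAnd of bexp & bexp.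

Inductive cmd : Type :=
| Skip
| SetI of nat & iexp & iexp & iexp   (* SetI x i j e is x[i, j] := e *)
| SetV of nat & iexp & iexp & vexp
| Seq of cmd & cmd
| If of bexp & cmd & cmd
| While of bexp & cmd.

Definition mem_of (T : Type) := nat -> nat -> nat -> T.

Definition upd (T : Type) (mu : mem_of T) (x i j : nat) (a : T) : mem_of T :=
  fun x' i' j' => if [&& x' == x, i' == i & j' == j] then a else mu x' i' j'.

Record state (R : realType) := State { imem : mem_of nat; vmem : mem_of R }.

Section Semantics.
Variable R : realType.
Implicit Type s : state R.

Fixpoint ieval s (e : iexp) : nat :=
  match e with
  | IConst k => k
  | IGet x e1 e2 => imem s x (ieval s e1) (ieval s e2)
  | IAdd e1 e2 => (ieval s e1 + ieval s e2)%N
  | ISub e1 e2 => (ieval s e1 - ieval s e2)%N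
  end.

Fixpoint veval s (e : vexp) : R :=
  match e with
  | VZero => 0
  | VGet x e1 e2 => vmem s x (ieval s e1) (ieval s e2)
  | VAdd e1 e2 => veval s e1 + veval s e2
  | VSub e1 e2 => veval s e1 - veval s e2
  end.

Fixpoint beval s (b : bexp) : bool :=
  match b with
  | BLeI e1 e2 => (ieval s e1 <= ieval s e2)%N
  | BLeV e1 e2 => veval s e1 <= veval s e2
  | BNot b1 => ~~ beval s b1
  | BAnd b1 b2 => beval s b1 && beval s b2
  end.

(* exec c s t s' : started in s, c halts in s' after t steps, a step being an *)
(* assignment, a test or a skip. Expressions are part of the program text, so *)
(* a step performs a number of elementary operations bounded independently of *)
(* the input.                                                                 *)
Inductive exec : cmd -> state R -> nat -> state R -> Prop :=
| ExecSkip s : exec Skip s 1 s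
| ExecSetI s x e1 e2 e :
    exec (SetI x e1 e2 e) s 1
      (State (upd (imem s) x (ieval s e1) (ieval s e2) (ieval s e)) (vmem s))
| ExecSetV s x e1 e2 e :
    exec (SetV x e1 e2 e) s 1
      (State (imem s) (upd (vmem s) x (ieval s e1) (ieval s e2) (veval s e)))
| ExecSeq c1 c2 s1 s2 s3 t1 t2 :
    exec c1 s1 t1 s2 -> exec c2 s2 t2 s3 ->
    exec (Seq c1 c2) s1 (t1 + t2) s3
| ExecIfTrue b c1 c2 s s' t :
    beval s b -> exec c1 s t s' -> exec (If b c1 c2) s t.+1 s'
| ExecIfFalse b c1 c2 s s' t :
    ~~ beval s b -> exec c2 s t s' -> exec (If b c1 c2) s t.+1 s'
| ExecWhileStop b c s :
    ~~ beval s b -> exec (While b c) s 1 s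
| ExecWhileLoop b c s1 s2 s3 t1 t2 :
    beval s1 b -> exec c s1 t1 s2 -> exec (While b c) s2 t2 s3 ->
    exec (While b c) s1 (t1 + t2).+1 s3.

Lemma exec_det c s t1 s1 t2 s2 :
  exec c s t1 s1 -> exec c s t2 s2 -> t1 = t2 /\ s1 = s2.
Proof.
move=> e1; elim: e1 t2 s2 => {c s t1 s1}.
- by move=> s t2 s2 e2; inversion e2.
- by move=> s x a b e t2 s2 e2; inversion e2.
- by move=> s x a b e t2 s2 e2; inversion e2.
- move=> c1 c2 s1 s2 s3 t1 t2 _ IH1 _ IH2 t' s' e2.
  inversion e2 as [| | |? ? ? sm ? u1 u2 H1 H2| | | |]; subst.
  by have [-> ?] := IH1 _ _ H1; subst sm; have [-> ->] := IH2 _ _ H2.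
- move=> b c1 c2 s s' t Hb _ IH t2 s2 e2.
  inversion e2 as [| | | |? ? ? ? ? ? Hb' H|? ? ? ? ? ? Hb' H| |]; subst.
    by have [-> ->] := IH _ _ H.
  by rewrite Hb in Hb'.
- move=> b c1 c2 s s' t Hb _ IH t2 s2 e2.
  inversion e2 as [| | | |? ? ? ? ? ? Hb' H|? ? ? ? ? ? Hb' H| |]; subst.
    by rewrite Hb' in Hb.
  by have [-> ->] := IH _ _ H.
- move=> b c s Hb t2 s2 e2.
  inversion e2 as [| | | | | | |? ? ? ? ? ? ? Hb' ? ?]; subst => //.
  by rewrite Hb' in Hb.
- move=> b c s1 s2 s3 t1 t2 Hb _ IH1 _ IH2 t' s' e2.
  inversion e2 as [| | | | | |? ? ? Hb'|? ? ? sm ? u1 u2 Hb' H1 H2]; subst.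
    by rewrite Hb in Hb'.
  by have [-> ?] := IH1 _ _ H1; subst sm; have [-> ->] := IH2 _ _ H2.
Qed.

Variables N M : finType.

(* Agents and goods are numbered by their position in enum N and enum M.      *)
(* Input: integer array 0 holds #|N| at [0, 0] and #|M| at [0, 1]; value      *)
(* array 0 holds v({g}) at [0, g]; value array 1 holds u_i({g}) at [i, g].    *)
(* All other cells are 0.                                                     *)
Definition input_imem : mem_of nat := fun x i j =>
  match x, i, j with
  | 0, 0, 0 => #|N|
  | 0, 0, 1 => #|M|
  | _, _, _ => 0
  end%N.

Definition input_vmem (v : {set M} -> R) (u : N -> {set M} -> R) : mem_of R :=
  fun x i j =>
  match x, i with
  | 0%N, 0%N => nth 0 [seq v [set g] | g <- enum M] j
  | 1%N, _ => nth 0 (nth [::] [seq [seq u a [set g] | g <- enum M]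
                                  | a <- enum N] i) j
  | _, _ => 0
  end.

Definition input_state (v : {set M} -> R) (u : N -> {set M} -> R) : state R :=
  State input_imem (input_vmem v u).

(* Output: integer array 1 holds at [g, 0] the number of the owner of g. *)
Definition outputs (s : state R) (A : {ffun N -> {set M}}) : Prop :=
  forall (i : N) (g : M),
    (g \in A i) = (imem s 1 (enum_rank g) 0 == enum_rank i :> nat).

End Semantics.

(* Main.v *)
Require Import Defs.
From mathcomp Require Import all_boot all_order all_algebra.
From mathcomp Require Import reals boolp.
From mathcomp Require Import zify lra.

(* Rank the goods by decreasing market value and cut the ranking into blocks  *)
(* of n consecutive goods. If every agent receives exactly one good of each   *)
(* block (at most one of the last, shorter block), then on every initial      *)
(* segment of the ranking the bundles differ in size by at most one, whence   *)
(* SD-EF1. Within a block the goods are assigned one at a time. If some agent *)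
(* not yet served in this block is envied by no other such agent, it takes    *)
(* its favourite remaining good of the block; otherwise the envy among these  *)
(* agents has a cycle, and rotating their bundles along it decreases the      *)
(* number of envious pairs. This keeps EF1: when j is served, an agent not    *)
(* yet served does not envy the old bundle of j, and an agent served earlier  *)
(* in the block prefers its own pick to the good that j takes. There are m    *)
(* picks, each preceded by at most n^2 rotations.                             *)

Set Implicit Arguments.
Unset Strict Implicit.
Unset Printing Implicit Defensive.

Import Order.TTheory GRing.Theory Num.Theory.

Local Open Scope ring_scope.

(** * Ranking the goods *)

(** The procedure outlined above maintains one invariant, [fair_partial], which contains both
    fairness notions for partial allocations. Three moves preserve it: a pick
    ([fair_partial_assign]), a rotation of bundles ([fair_partial_rotate]) and the passage to the
    next block ([fair_partial_next_block]).

    SD-EF1 is a statement about initial segments of the ranking: by [rank_segment] the goods of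
    value at least [v g] form such a segment. If the bundles differ by at most one there, dropping
    the best-ranked good of the other bundle suffices, for all segments at once ([transfer_SD_EF1]).
    For the subjective utilities, [ef1_safe] looks one pick ahead: an agent served earlier in the
    block took a good it likes at least as much as every good left there, and this pays for whatever
    another agent takes later.

    If every waiting agent is envied by a waiting agent, following enviers leads into a cycle
    ([iter_periodic]), and rotating along it lowers the number of envious pairs
    ([envy_count_rotate]). So the loop terminates after polynomially many rounds. The procedure is a
    while program, analysed with timed triples ([runs]) up to [runs_allocate]; existence of the
    allocation follows from the halting run. *)

Section Rank.
Variables (R : realType) (m : nat) (v : nat -> R).

(** Decreasing value with ties broken by index, a strict total order. The strict comparison is a
    negated [<=] because this is the form of the test in [init_cmd]. *)
Definition before (g' g : nat) : bool :=
  ~~ (v g' <= v g) || (v g <= v g') && (g' < g)%N.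

Definition rank (g : nat) : nat := (\sum_(k < m) before k g)%N.

Lemma rank_card g : rank g = #|[set k : 'I_m | before k g]|.
Proof.
rewrite -sum1_card big_mkcond; apply: eq_bigr => k _.
by rewrite inE; case: before.
Qed.

Lemma before_irr g : before g g = false.
Proof. by rewrite /before lexx ltnn. Qed.

Lemma before_total g h : g != h -> before g h || before h g.
Proof.
rewrite /before; case: (ltgtP (v g) (v h)) => //= _.
by rewrite neq_ltn.
Qed.

Lemma before_trans g h k : before g h -> before h k -> before g k.
Proof.
rewrite /before -!ltNge.
case: (ltgtP (v h) (v g)) => //= [hg|->].
  move=> _; case: (ltgtP (v k) (v h)) => //= [kh|->]; last by rewrite hg.
  by rewrite (lt_trans kh hg).
case: (ltgtP (v k) (v g)) => //= _; exact: ltn_trans.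
Qed.

Lemma rank_lt g h : (g < m)%N -> before g h -> (rank g < rank h)%N.
Proof.
move=> gm gh; rewrite !rank_card; apply/proper_card/properP; split.
  by apply/subsetP => k; rewrite !inE => /before_trans; apply.
by exists (Ordinal gm); rewrite !inE ?gh //= before_irr.
Qed.

Lemma rank_inj g h : (g < m)%N -> (h < m)%N -> rank g = rank h -> g = h.
Proof.
move=> gm hm e; apply/eqP; case: eqVneq => // /before_total/orP[] /rank_lt;
  by rewrite e ltnn => ->.
Qed.

Lemma rank_ltm g : (g < m)%N -> (rank g < m)%N.
Proof.
move=> gm; rewrite rank_card -[X in (_ < X)%N]card_ord -cardsT.
apply/proper_card/properP; split; first exact: subsetT.
by exists (Ordinal gm); rewrite !inE ?before_irr.
Qed.

(** Whatever precedes a member of [S] is in [S], and the member does not precede itself, so it has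
    fewer than [#|S|] predecessors; a good outside [S] is preceded by all of [S]. *)
Lemma rank_segment (g : 'I_m) : let S := [set h : 'I_m | v g <= v h] in
  forall h : 'I_m, (h \in S) = (rank h < #|S|)%N.
Proof.
move=> S h; rewrite rank_card inE; case: (lerP (v g) (v h)) => gh.
  apply/esym/proper_card/properP; split.
    apply/subsetP => k; rewrite !inE /before -ltNge.
    by case/orP => [/ltW|/andP[+ _]]; apply: le_trans.
  by exists h; rewrite !inE ?before_irr.
apply/esym/negbTE; rewrite -leqNgt; apply/subset_leq_card/subsetP => k.
by rewrite !inE /before -ltNge => /(lt_le_trans gh) ->.
Qed.

End Rank.

Lemma card_ord_lt m K : (K <= m)%N -> #|[set i : 'I_m | (i < K)%N]| = K.
Proof.
move=> Km; rewrite -sum1_card.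
rewrite (eq_bigl (fun i : 'I_m => (i < K)%N)); last by move=> i; rewrite inE.
by rewrite (big_ord_narrow Km) sum1_card card_ord.
Qed.

Lemma card_inj_lt m (f : nat -> nat) K :
  (forall g, g < m -> f g < m)%N ->
  (forall g h, (g < m)%N -> (h < m)%N -> f g = f h -> g = h) ->
  (K <= m)%N -> #|[set g : 'I_m | (f g < K)%N]| = K.
Proof.
move=> fm finj Km; pose p (g : 'I_m) := Ordinal (fm g (ltn_ord g)).
have pinj : injective p.
  by move=> g h /(congr1 val) /= /finj e; apply: val_inj; apply: e.
rewrite -[RHS](card_ord_lt Km) -[RHS](card_preimset _ pinj).
by apply: eq_card => g; rewrite !inE.
Qed.

(** * Partial allocations that are fair *)

Section Fair.
Variables (R : realType) (n m : nat) (u : nat -> nat -> R) (rk : nat -> nat).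
Implicit Types (own pk h : nat -> nat) (i j g K b t a best : nat).

Hypothesis u_ge0 : forall i g, 0 <= u i g.
Hypothesis rk_ltm : forall g, (g < m)%N -> (rk g < m)%N.
Hypothesis rk_inj :
  forall g g', (g < m)%N -> (g' < m)%N -> rk g = rk g' -> g = g'.

(* [own g = n] means that g is not allocated yet. *)
Definition share own i j : R := \sum_(g < m | own g == j) u i g.

Definition held own i K : nat :=
  #|[set g : 'I_m | (own g == i) && (rk g < K)%N]|.

Definition ef1 own i j : Prop :=
  share own i j <= share own i i \/
  exists g, [/\ (g < m)%N, own g = j & share own i j - u i g <= share own i i].

(** Only the upper end of the block is tested: by [fp_low] the goods of rank below [b] are already
    allocated. *)
Definition open own b g : bool := (own g == n) && (rk g < b + n)%N.

(** This ensures that [ef1 own i j] survives the next pick of [j], whichever open good it takes: in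
    the first case the new good is the one to remove, in the second it is [g]. *)
Definition ef1_safe own b i j : Prop :=
  share own i j <= share own i i \/
  exists g, [/\ (g < m)%N, own g = j & forall g', (g' < m)%N ->
    open own b g' -> share own i j - u i g + u i g' <= share own i i].

(* The goods of rank below b have been allocated, the goods of rank in        *)
(* [b, b + n) are being allocated, t goods are allocated in total, and the    *)
(* agent i has received a good of the current block iff b < pk i.             *)
Record fair_partial own pk b t : Prop := FairPartial {
  fp_own : forall g, (g < m)%N -> (own g <= n)%N;
  fp_count : #|[set g : 'I_m | (own g < n)%N]| = t;
  fp_block : (b <= t <= b + n)%N;
  fp_top : forall g, (g < m)%N -> (own g < n)%N -> (rk g < b + n)%N;
  fp_low : forall g, (g < m)%N -> (rk g < b)%N -> (own g < n)%N;
  fp_pk : forall i, (i < n)%N -> (pk i <= t)%N;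
  fp_served : #|[set i : 'I_n | (b < pk i)%N]| = (t - b)%N;
  fp_sd : forall i j K, (i < n)%N -> (j < n)%N ->
    (held own i K <= (held own j K).+1)%N;
  fp_bal : forall i j, (i < n)%N -> (j < n)%N -> held own i b = held own j b;
  fp_cur : forall i, (i < n)%N ->
    held own i (b + n) = (held own i b + (b < pk i))%N;
  fp_ef1 : forall i j, (i < n)%N -> (j < n)%N -> ef1 own i j;
  fp_safe : forall i j, (i < n)%N -> (j < n)%N ->
    (b < pk i)%N -> (pk j <= b)%N -> ef1_safe own b i j }.

(** Restricted to agents not yet served in the block, so that rotations stay among them and every
    agent keeps its number of goods from the current block. *)
Definition envies own pk b i j : bool :=
  [&& (pk i <= b)%N, (pk j <= b)%N & share own i i < share own i j].

Definition envy_count own pk b : nat :=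
  #|[set p : 'I_n * 'I_n | envies own pk b p.1 p.2]|.

Lemma envy_count_le own pk b : (envy_count own pk b <= n * n)%N.
Proof. by rewrite -[X in (X * X)%N](card_ord n) -card_prod max_card. Qed.

Lemma held_homo own i K K' : (K <= K')%N -> (held own i K <= held own i K')%N.
Proof.
move=> le; apply/subset_leq_card/subsetP => g; rewrite !inE.
by case/andP=> -> /leq_trans; apply.
Qed.

Lemma fair_partial_init own pk :
  (forall g, (g < m)%N -> own g = n) -> (forall i, pk i = 0%N) ->
  fair_partial own pk 0 0.
Proof.
move=> ownn pk0.
have held0 i K : (i < n)%N -> held own i K = 0%N.
  move=> ilt; apply/eqP; rewrite cards_eq0; apply/eqP/setP => g; rewrite !inE.
  by rewrite ownn // (gtn_eqF ilt).
have share0 i j : (j < n)%N -> share own i j = 0.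
  by move=> jlt; apply: big1 => g; rewrite ownn // (gtn_eqF jlt).
split=> //.
- by move=> g /ownn ->.
- apply/eqP; rewrite cards_eq0; apply/eqP/setP => g; rewrite !inE.
  by rewrite ownn // ltnn.
- by move=> g gm; rewrite ownn // ltnn.
- by move=> i _; rewrite pk0.
- by apply/eqP; rewrite cards_eq0; apply/eqP/setP => i; rewrite !inE pk0.
- by move=> i j K *; rewrite !held0.
- by move=> i j *; rewrite !held0.
- by move=> i *; rewrite !held0 // pk0.
- by move=> i j *; left; rewrite !share0.
- by move=> i j *; left; rewrite !share0.
Qed.

Lemma fair_partial_le own pk b t : fair_partial own pk b t -> (t <= m)%N.
Proof.
by move=> fp; rewrite -(fp_count fp) -[X in (_ <= X)%N](card_ord m) max_card.
Qed.

(** After [n] picks everyone has been served, and the [t] allocated goods, all of rank below [t],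
    are exactly the first [t]. Since [pk] records times of picks, raising the base to [t] makes
    every agent unserved without any reset, and [fp_safe] becomes vacuous. *)
Lemma fair_partial_next_block own pk b t :
  fair_partial own pk b t -> t = (b + n)%N -> fair_partial own pk t t.
Proof.
move=> fp tE; have tm := fair_partial_le fp.
have all_served i : (i < n)%N -> (b < pk i)%N.
  move=> ilt; have: [set i : 'I_n | (b < pk i)%N] == [set: 'I_n].
    by rewrite eqEcard subsetT cardsT card_ord (fp_served fp) tE addKn /=.
  by move/eqP/setP/(_ (Ordinal ilt)); rewrite !inE.
have heldt i : (i < n)%N -> held own i t = (held own i b).+1.
  by move=> ilt; rewrite tE (fp_cur fp) // all_served // addn1.
have low g : (g < m)%N -> (rk g < t)%N -> (own g < n)%N.
  move=> gm rg; have: [set g : 'I_m | (own g < n)%N] ==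
                       [set g : 'I_m | (rk g < t)%N].
    rewrite eqEcard (fp_count fp) card_inj_lt // leqnn andbT.
    by apply/subsetP => k; rewrite !inE tE => /(fp_top fp); apply.
  by move/eqP/setP/(_ (Ordinal gm)); rewrite !inE rg.
split=> //.
- exact: (fp_own fp).
- exact: (fp_count fp).
- by rewrite leqnn leq_addr.
- move=> g gm /(fp_top fp gm); rewrite -tE => /leq_trans; apply.
  exact: leq_addr.
- exact: (fp_pk fp).
- rewrite subnn; apply/eqP; rewrite cards_eq0; apply/eqP/setP => i.
  by rewrite !inE ltnNge (fp_pk fp).
- exact: (fp_sd fp).
- by move=> i j ilt jlt; rewrite !heldt // (fp_bal fp ilt jlt).
- move=> i ilt; rewrite ltnNge (fp_pk fp) // addn0.
  apply: eq_card => g; rewrite !inE; case: eqP => //= oi.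
  have rg : (rk g < t)%N by rewrite tE (fp_top fp) // oi.
  by rewrite rg (leq_trans rg) // leq_addr.
- exact: (fp_ef1 fp).
- by move=> i j ilt _; rewrite ltnNge (fp_pk fp).
Qed.

Lemma fair_partial_free own pk b t : (0 < n)%N ->
  fair_partial own pk b t -> (t < b + n)%N ->
  exists2 i, (i < n)%N & (pk i <= b)%N.
Proof.
move=> n_gt0 fp tlt; apply: contrapT => H.
suff: #|[set i : 'I_n | (b < pk i)%N]| = n.
  by rewrite (fp_served fp); move: tlt (fp_block fp); lia.
rewrite -[RHS]card_ord -cardsT; congr #|pred_of_set _|; apply/setP => i.
rewrite !inE ltnNge; apply/negP => ib; apply: H; by exists i.
Qed.

(** Otherwise the [t + 1] goods of rank at most [t] would all be among the [t] allocated ones. *)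
Lemma fair_partial_open own pk b t :
  fair_partial own pk b t -> (t < b + n)%N -> (t < m)%N ->
  exists2 g, (g < m)%N & open own b g.
Proof.
move=> fp tlt tm; apply: contrapT => H.
suff: (#|[set g : 'I_m | (rk g < t.+1)%N]| <= t)%N by rewrite card_inj_lt // ltnn.
rewrite -[X in (_ <= X)%N](fp_count fp); apply/subset_leq_card/subsetP => g.
rewrite !inE => rg; rewrite ltn_neqAle (fp_own fp) // andbT.
apply/negP => og; apply: H; exists g => //; rewrite /open og.
exact: leq_trans rg tlt.
Qed.

Lemma held_assign own own' a best : (best < m)%N -> own best = n ->
  (forall g, own' g = if g == best then a else own g) ->
  forall i K, (i < n)%N ->
  held own' i K = (held own i K + ((i == a) && (rk best < K)))%N.
Proof.
move=> bm ob own'E i K ilt; pose o := Ordinal bm.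
have ni : (own best == i) = false by rewrite ob gtn_eqF.
rewrite /held (cardsD1 o) addnC; congr (_ + _)%N.
  apply: eq_card => g; rewrite !inE own'E -val_eqE /=.
  by case: (eqVneq (g : nat) best) => //= ->; rewrite ni.
by rewrite !inE own'E /= eqxx eq_sym.
Qed.

Lemma share_assign own own' a best : (best < m)%N -> own best = n ->
  (forall g, own' g = if g == best then a else own g) ->
  forall i j, (j < n)%N ->
  share own' i j = share own i j + (if j == a then u i best else 0).
Proof.
move=> bm ob own'E i j jlt; pose o := Ordinal bm.
have nj : (own best == j) = false by rewrite ob gtn_eqF.
rewrite /share big_mkcond (bigD1 o) //= [in RHS]big_mkcond [in RHS](bigD1 o) //=.
rewrite nj add0r own'E eqxx addrC eq_sym; congr (_ + _).
by apply: eq_bigr => g; rewrite -val_eqE /= own'E => /negbTE ->.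
Qed.

Lemma fair_partial_assign own own' pk pk' b t a best :
  fair_partial own pk b t -> (t < b + n)%N -> (a < n)%N -> (pk a <= b)%N ->
  (forall i, (i < n)%N -> ~~ envies own pk b i a) ->
  (best < m)%N -> open own b best ->
  (forall g, (g < m)%N -> open own b g -> u a g <= u a best) ->
  (forall g, own' g = if g == best then a else own g) ->
  (forall i, pk' i = if i == a then t.+1 else pk i) ->
  fair_partial own' pk' b t.+1.
Proof.
move=> fp tlt an pa src bm /andP[/eqP ob rb] bmax own'E pk'E.
have heldE := held_assign bm ob own'E.
have shareE := share_assign bm ob own'E.
have own'lt g : (own' g < n)%N = (g == best) || (own g < n)%N.
  by rewrite own'E; case: eqP.
have b_le : (b <= rk best)%N.
  by rewrite leqNgt; apply/negP => /(fp_low fp bm); rewrite ob ltnn.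
have open' g : open own' b g -> open own b g.
  by rewrite /open own'E; case: (eqVneq g best) => // _ ; rewrite (ltn_eqF an).
have bt := fp_block fp.
split.
- by move=> g gm; rewrite own'E; case: eqP => _; [exact: ltnW|exact: (fp_own fp)].
- rewrite (cardsD1 (Ordinal bm)) inE own'lt /= eqxx /= add1n -(fp_count fp).
  congr _.+1; apply: eq_card => g; rewrite !inE own'lt -val_eqE /=.
  by case: eqP => //= ->; rewrite ob ltnn.
- by move: bt tlt; lia.
- move=> g gm; rewrite own'lt => /orP[/eqP -> //|]; exact: (fp_top fp).
- by move=> g gm rg; rewrite own'lt (fp_low fp) // orbT.
- by move=> i ilt; rewrite pk'E; case: eqP => // _; apply: leqW; exact: (fp_pk fp).
- rewrite (cardsD1 (Ordinal an)) inE pk'E /= eqxx.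
  have -> : (b < t.+1)%N by move: bt; lia.
  rewrite subSn; last by move: bt; lia.
  rewrite -(fp_served fp) add1n; congr _.+1; apply: eq_card => i.
  rewrite !inE pk'E -val_eqE /=; case: eqP => //= ->.
  by rewrite ltnNge pa.
(* The critical case is [i = a] with [best] inside the segment. The waiting agent [a] held nothing
   of rank [b] or more, so its count was its count below [b], which is the same for all agents; it
   was thus at most that of [j]. *)
- move=> i j K ilt jlt; rewrite !heldE //.
  have := fp_sd fp K ilt jlt; case: eqP => [ia|_] /=; last by lia.
  case: ltnP => rK /=; last by lia.
  move=> _; have : (held own i K <= held own j K)%N; last by case: (_ && _); lia.
  apply: (@leq_trans (held own j b)); last first.
    by apply: held_homo; exact: leq_trans b_le (ltnW rK).
  rewrite -(fp_bal fp ilt jlt); move: (fp_cur fp ilt).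
  rewrite ia ltnNge pa addn0 => <-; apply/subset_leq_card/subsetP => g.
  rewrite !inE => /andP[/eqP oa _]; rewrite oa eqxx /=.
  by apply: (fp_top fp) => //; rewrite oa.
- move=> i j ilt jlt; rewrite !heldE // (ltnNge (rk best)) b_le !andbF !addn0.
  exact: (fp_bal fp).
- move=> i ilt; rewrite !heldE // (ltnNge (rk best) b) b_le rb andbT andbF addn0.
  rewrite (fp_cur fp) // pk'E; case: eqP => [->|_]; last by rewrite addn0.
  by rewrite (ltnNge b (pk a)) pa addn0; congr (_ + nat_of_bool _)%N; move: bt; lia.
(* Only the bundle of [a] grows. A waiting agent did not envy it before and removes [best]; a served
   agent relies on [fp_safe], as [best] was open. *)
- move=> i j ilt jlt; rewrite /ef1 !shareE //.
  have [->|ja] := eqVneq j a.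
    have [->|ia] := eqVneq i a; first by left.
    right; case: (leqP (pk i) b) => [ib|ib].
      exists best; rewrite own'E eqxx addrK addr0; split=> //.
      by move: (src _ ilt); rewrite /envies ib pa /= -leNgt.
    case: (fp_safe fp ilt an ib pa) => [le|[g [gm oa H]]].
      by exists best; rewrite own'E eqxx addrK addr0; split.
    exists g; split=> //.
      by rewrite own'E; case: eqP => // e; move: oa; rewrite e.
    by rewrite addr0 addrAC; apply: H => //; rewrite /open ob eqxx.
  rewrite addr0; have [ge0] : 0 <= (if i == a then u i best else 0) by case: ifP.
  case: (fp_ef1 fp ilt jlt) => [le|[g [gm oj H]]]; first by left; lra.
  right; exists g; split=> //; last by lra.
  by rewrite own'E; case: eqP => // e; move: oj jlt; rewrite e ob => ->; rewrite ltnn.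
(* The newly served agent is the new case: its gain [u a best] is at least the value to it of any
   good still open, so the old EF1 witness absorbs the next pick of [j]. *)
- move=> i j ilt jlt; rewrite !pk'E /ef1_safe !shareE //.
  have [->|ja] := eqVneq j a; first by move: bt; lia.
  have ownj g : own g = j -> own' g = j.
    by rewrite own'E; case: eqP => // -> oj; move: jlt; rewrite -oj ob ltnn.
  rewrite addr0; have [->|ia] := eqVneq i a => [_ jb|ib jb].
    have ge0 := u_ge0 a best.
    case: (fp_ef1 fp an jlt) => [le|[g [gm oj H]]]; first by left; lra.
    right; exists g; split=> //; first exact: ownj.
    by move=> g' gm' /open' /(bmax _ gm') le; lra.
  rewrite addr0; case: (fp_safe fp ilt jlt ib jb) => [le|[g [gm oj H]]].
    by left.
  right; exists g; split=> //; first exact: ownj.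
  by move=> g' gm' /open'; apply: H.
Qed.

(** * Passing each bundle from [j] to [h j], for a permutation [h] of the agents *)

Section Rotate.
Variables (own own' pk h : nat -> nat) (b : nat).
Hypothesis h_lt : forall i, (i < n)%N -> (h i < n)%N.
Hypothesis h_inj : forall i j, (i < n)%N -> (j < n)%N -> h i = h j -> i = j.
Hypothesis own'E :
  forall g, (g < m)%N -> own' g = if (own g < n)%N then h (own g) else own g.

Lemma rotate_surj j : (j < n)%N -> exists2 i, (i < n)%N & h i = j.
Proof.
move=> jlt; pose p (i : 'I_n) := Ordinal (h_lt (ltn_ord i)).
have pinj : injective p.
  by move=> x y /(congr1 val) /= /h_inj e; apply: val_inj; apply: e.
have [q pq qp] := injF_bij pinj.
by exists (q (Ordinal jlt)) => //; have /(congr1 val) := qp (Ordinal jlt).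
Qed.

Lemma rotate_own g j : (g < m)%N -> (j < n)%N -> (own' g == h j) = (own g == j).
Proof.
move=> gm jlt; rewrite own'E //; case: ltnP => og.
  by apply/eqP/eqP => [/h_inj|->] //; apply.
by rewrite !gtn_eqF //; apply: leq_trans og => //; apply: h_lt.
Qed.

Lemma rotate_own_lt g : (g < m)%N -> (own' g < n)%N = (own g < n)%N.
Proof.
move=> gm; rewrite own'E //; case: (ltnP (own g) n) => og; first exact: h_lt.
by rewrite ltnNge og.
Qed.

Lemma rotate_open g : (g < m)%N -> open own' b g = open own b g.
Proof.
move=> gm; rewrite /open; congr (_ && _); rewrite own'E //.
by case: ltnP => // og; rewrite !ltn_eqF // h_lt.
Qed.

Lemma rotate_share i j : (j < n)%N -> share own' i (h j) = share own i j.
Proof. by move=> jlt; apply: eq_bigl => g; rewrite rotate_own. Qed.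

Lemma rotate_held j K : (j < n)%N -> held own' (h j) K = held own j K.
Proof. by move=> jlt; apply: eq_card => g; rewrite !inE rotate_own. Qed.

Hypothesis h_free : forall i, (i < n)%N -> (b < pk (h i))%N = (b < pk i)%N.
Hypothesis h_improves : forall i, (i < n)%N ->
  share own (h i) (h i) <= share own (h i) i.

Lemma rotate_improves i : (i < n)%N -> share own i i <= share own' i i.
Proof.
move=> ilt; have [k klt <-] := rotate_surj ilt.
by rewrite rotate_share //; apply: h_improves.
Qed.

(** The bundles themselves do not change, so the counts are only relabelled, and [h_free] keeps
    served and waiting agents apart. Each agent's own share does not decrease, so every bound
    against a bundle survives under its new owner. *)
Lemma fair_partial_rotate t :
  fair_partial own pk b t -> fair_partial own' pk b t.
Proof.
move=> fp; split.
- move=> g gm; have := fp_own fp gm; rewrite own'E //.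
  by case: ltnP => // /h_lt/ltnW.
- by rewrite -(fp_count fp); apply: eq_card => g; rewrite !inE rotate_own_lt.
- exact: (fp_block fp).
- by move=> g gm; rewrite rotate_own_lt //; apply: (fp_top fp).
- by move=> g gm; rewrite rotate_own_lt //; apply: (fp_low fp).
- exact: (fp_pk fp).
- exact: (fp_served fp).
- move=> i j K /rotate_surj[i0 i0n <-] /rotate_surj[j0 j0n <-].
  by rewrite !rotate_held //; apply: (fp_sd fp).
- move=> i j /rotate_surj[i0 i0n <-] /rotate_surj[j0 j0n <-].
  by rewrite !rotate_held //; apply: (fp_bal fp).
- move=> i /rotate_surj[i0 i0n <-].
  by rewrite !rotate_held // h_free //; apply: (fp_cur fp).
- move=> i j ilt /rotate_surj[j0 j0n <-]; rewrite /ef1 rotate_share //.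
  have le := rotate_improves ilt.
  case: (fp_ef1 fp ilt j0n) => [?|[g [gm oj ?]]]; first by left; lra.
  right; exists g; split=> //; last by lra.
  by apply/eqP; rewrite rotate_own // oj.
- move=> i j ilt /rotate_surj[j0 j0n <-] ib jb; rewrite /ef1_safe rotate_share //.
  have le := rotate_improves ilt.
  have j0b : (pk j0 <= b)%N by move: (h_free j0n) jb; lia.
  case: (fp_safe fp ilt j0n ib j0b) => [?|[g [gm oj H]]]; first by left; lra.
  right; exists g; split=> //; first by apply/eqP; rewrite rotate_own // oj.
  by move=> g' gm'; rewrite rotate_open // => /H - /(_ gm') ?; lra.
Qed.

(** An agent that envies a bundle after the rotation envied it before, under its old owner: this
    injects the new envious pairs into the old ones. The pair [(h c, c)] is missed, because [h c]
    now owns that bundle. *)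
Lemma envy_count_rotate c : (c < n)%N -> envies own pk b (h c) c ->
  (envy_count own' pk b < envy_count own pk b)%N.
Proof.
move=> cn hc; pose p (x : 'I_n * 'I_n) := (x.1, Ordinal (h_lt (ltn_ord x.2))).
have pinj : injective p.
  move=> [x y] [x' y'] [] /= -> /h_inj e; congr (_, _).
  by apply: val_inj; apply: e.
rewrite /envy_count -(card_preimset _ pinj); apply/proper_card/properP.
have pkE (x : 'I_n) : (pk (h x) <= b)%N = (pk x <= b)%N.
  by have := h_free (ltn_ord x); lia.
split.
  apply/subsetP => -[x y]; rewrite !inE /envies /= pkE rotate_share //.
  case/and3P => -> -> /=; apply: le_lt_trans; exact: rotate_improves.
exists (Ordinal (h_lt cn), Ordinal cn); rewrite !inE //=.
by rewrite /envies /= ltxx !andbF.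
Qed.

End Rotate.

End Fair.

(** * The cycle reached by iterating a self-map *)

Section Cycle.
Variables (n : nat) (P : pred nat) (f : nat -> nat) (c0 : nat).
Hypothesis f_lt : forall i, (i < n)%N -> P i -> (f i < n)%N && P (f i).
Hypothesis c0_lt : (c0 < n)%N && P c0.

Let c := iter n f c0.

(** The period of [c] is at most [n], so [n] steps from [c] cover its whole cycle. *)
Definition rotation i := if i \in traject f c n then f i else i.

Lemma iter_lt k : (iter k f c0 < n)%N && P (iter k f c0).
Proof. by elim: k => //= k /andP[]; exact: f_lt. Qed.

(* Pigeonhole: after n steps the walk from c0 has entered a cycle. *)
Lemma iter_periodic : exists2 p, (0 < p <= n)%N & iter p f c = c.
Proof.
have : looping f c0 n.
  rewrite -[looping _ _ _]negbK -looping_uniq; apply/negP => u.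
  suff /(uniq_leq_size u) : {subset traject f c0 n.+1 <= iota 0 n}.
    by rewrite size_traject size_iota ltnn.
  by move=> x /trajectP[k _ ->]; rewrite mem_iota; case/andP: (iter_lt k).
move=> /trajectP[k kn e]; exists (n - k)%N; first by lia.
rewrite {1}/c e -iterD subnK; last exact: ltnW.
by [].
Qed.

Lemma traject_lt i : i \in traject f c n -> (i < n)%N && P i.
Proof. by case/trajectP => k _ ->; rewrite /c -iterD iter_lt. Qed.

Lemma traject_closed i : i \in traject f c n -> f i \in traject f c n.
Proof.
have [p /andP[p0 pn] pc] := iter_periodic.
case/trajectP => k kn ->; rewrite -iterS; apply/trajectP.
have [lt|ge] := ltnP k.+1 n; first by exists k.+1.
exists (k.+1 - p)%N; first by lia.
by rewrite -[in LHS](@subnK p k.+1) ?iterD ?pc //; lia.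
Qed.

Lemma rotation_lt i : (i < n)%N -> (rotation i < n)%N.
Proof.
by rewrite /rotation; case: ifP => // /traject_closed/traject_lt/andP[].
Qed.

Lemma rotation_free i : P (rotation i) = P i.
Proof.
rewrite /rotation; case: ifP => // it.
have /andP[_ ->] := traject_lt it.
by have /andP[] := traject_lt (traject_closed it).
Qed.

(** On the cycle [f] is undone by [p - 1] further steps; elsewhere the map is the identity, and the
    two parts cannot collide since the cycle is closed under [f]. *)
Lemma rotation_inj : injective rotation.
Proof.
have [p /andP[p0 pn] pc] := iter_periodic.
have pK i : i \in traject f c n -> iter p.-1 f (f i) = i.
  case/trajectP => k _ ->.
  by rewrite -iterSr prednK // -iterD addnC iterD pc.
move=> i j; rewrite /rotation; case: ifP => it; case: ifP => jt //.
- by move=> e; rewrite -(pK _ it) e pK.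
- by move=> e; rewrite -e traject_closed in jt.
- by move=> e; rewrite e traject_closed in it.
Qed.

Lemma rotation_moves : [/\ (c < n)%N, P c & rotation c = f c].
Proof.
have /andP[cn Pc] := iter_lt n; split=> //; rewrite /rotation ifT //.
by apply/trajectP; exists 0; first by case: (n) cn.
Qed.

End Cycle.

(** * Timed triples for while programs *)

Fixpoint iwrites (c : cmd) : seq nat :=
  match c with
  | SetI x _ _ _ => [:: x]
  | Seq c1 c2 | If _ c1 c2 => iwrites c1 ++ iwrites c2
  | While _ c1 => iwrites c1
  | _ => [::]
  end.

Fixpoint vwrites (c : cmd) : seq nat :=
  match c with
  | SetV x _ _ _ => [:: x]
  | Seq c1 c2 | If _ c1 c2 => vwrites c1 ++ vwrites c2
  | While _ c1 => vwrites c1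
  | _ => [::]
  end.

Definition ge_ (e1 e2 : iexp) : bexp := BLeI e2 e1.
Definition lt_ (e1 e2 : iexp) : bexp := BNot (BLeI e2 e1).
Definition eq_ (e1 e2 : iexp) : bexp := BAnd (BLeI e1 e2) (BLeI e2 e1).
Definition reg (x : nat) : iexp := IGet x (IConst 0) (IConst 0).
Definition cell (x : nat) (e : iexp) : iexp := IGet x e (IConst 0).
Definition set_reg (x : nat) (e : iexp) : cmd := SetI x (IConst 0) (IConst 0) e.
Definition set_cell (x : nat) (e1 e : iexp) : cmd := SetI x e1 (IConst 0) e.

(* Array 0 holds the two sizes, at [0, 0] and [0, 1]. *)
Definition size_ (y : nat) : iexp := IGet 0 (IConst 0) (IConst y).

Definition For (x y : nat) (c : cmd) : cmd :=
  Seq (set_reg x (IConst 0))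
    (While (lt_ (reg x) (size_ y))
       (Seq c (set_reg x (IAdd (reg x) (IConst 1))))).

(** Each round pays for the body, the increment and the test; the final 2 pays for the
    initialisation and the failing test. *)
Definition for_cost (L T : nat) : nat := (L * T.+2 + 2)%N.

Section Runs.
Variable R : realType.
Implicit Types (s : state R) (c : cmd) (Q : state R -> Prop).

Definition keeps c s s' : Prop :=
  (forall x, x \notin iwrites c -> imem s' x = imem s x) /\
  (forall x, x \notin vwrites c -> vmem s' x = vmem s x).

Lemma upd_other (T : Type) (mu : mem_of T) x i j a x' :
  x' != x -> upd mu x i j a x' = mu x'.
Proof.
by move=> /negbTE ne; apply/funext => k; apply/funext => l; rewrite /upd ne.
Qed.

Lemma exec_keeps c s t s' : exec c s t s' -> keeps c s s'.
Proof.
elim=> {c s t s'}.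
- by [].
- by move=> s x e1 e2 e; split=> y //=; rewrite inE; apply: upd_other.
- by move=> s x e1 e2 e; split=> y //=; rewrite inE; apply: upd_other.
- move=> c1 c2 s1 s2 s3 t1 t2 _ [I1 V1] _ [I2 V2].
  split=> x /=; rewrite mem_cat negb_or => /andP[x1 x2].
    by rewrite I2 ?I1.
  by rewrite V2 ?V1.
- move=> b c1 c2 s s' t _ _ [I1 V1].
  by split=> x /=; rewrite mem_cat negb_or => /andP[]; [move/I1|move/V1].
- move=> b c1 c2 s s' t _ _ [I2 V2].
  by split=> x /=; rewrite mem_cat negb_or => /andP[_]; [move/I2|move/V2].
- by [].
- move=> b c s1 s2 s3 t1 t2 _ _ [I1 V1] _ [I2 V2].
  split=> x /= nx; first by rewrite I2 ?I1.
  by rewrite V2 ?V1.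
Qed.

Definition runs c s T Q : Prop :=
  exists t s', [/\ exec c s t s', (t <= T)%N & Q s'].

(** Handing [keeps] to the new postcondition acts as a frame rule: a triple need only describe what
    its command changes. *)
Lemma runs_weaken c s T Q T' Q' : runs c s T Q -> (T <= T')%N ->
  (forall s', Q s' -> keeps c s s' -> Q' s') -> runs c s T' Q'.
Proof.
case=> t [s' [e le q]] le' QQ; exists t, s'; split=> //.
  exact: leq_trans le'.
by apply: QQ => //; exact: exec_keeps e.
Qed.

Lemma runs_leq c s T T' Q : (T <= T')%N -> runs c s T Q -> runs c s T' Q.
Proof. by move=> le H; apply: runs_weaken H le _. Qed.

Lemma runs_skip s Q : Q s -> runs Skip s 1 Q.
Proof. by exists 1%N, s; split=> //; constructor. Qed.

Lemma runs_seti s x e1 e2 e Q :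
  Q (State (upd (imem s) x (ieval s e1) (ieval s e2) (ieval s e)) (vmem s)) ->
  runs (SetI x e1 e2 e) s 1 Q.
Proof. by move=> q; eexists _, _; split; [constructor| |exact: q]. Qed.

Lemma runs_setv s x e1 e2 e Q :
  Q (State (imem s) (upd (vmem s) x (ieval s e1) (ieval s e2) (veval s e))) ->
  runs (SetV x e1 e2 e) s 1 Q.
Proof. by move=> q; eexists _, _; split; [constructor| |exact: q]. Qed.

Lemma runs_seq c1 c2 s T1 T2 Q :
  runs c1 s T1 (fun s' => runs c2 s' T2 Q) -> runs (Seq c1 c2) s (T1 + T2) Q.
Proof.
case=> t1 [s1 [e1 le1 [t2 [s2 [e2 le2 q]]]]].
exists (t1 + t2)%N, s2; split=> //; last exact: leq_add.
exact: ExecSeq e1 e2.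
Qed.

Lemma runs_if b c1 c2 s T Q :
  (beval s b -> runs c1 s T Q) -> (~~ beval s b -> runs c2 s T Q) ->
  runs (If b c1 c2) s T.+1 Q.
Proof.
move=> H1 H2; have [bs|bs] := boolP (beval s b).
  by have [t [s' [e le q]]] := H1 bs; exists t.+1, s'; split=> //; constructor.
have [t [s' [e le q]]] := H2 bs; exists t.+1, s'; split=> //; exact: ExecIfFalse.
Qed.

Lemma runs_while b c (Inv : state R -> Prop) (mu : state R -> nat) T s :
  Inv s ->
  (forall s1, Inv s1 -> beval s1 b ->
     runs c s1 T (fun s2 => Inv s2 /\ (mu s2 < mu s1)%N)) ->
  runs (While b c) s (mu s * T.+1 + 1) (fun s1 => Inv s1 /\ ~~ beval s1 b).
Proof.
move=> I body; have [k] := ubnP (mu s); elim: k s I => // k IH s I lt.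
have [bs|bs] := boolP (beval s b); last first.
  by exists 1%N, s; split=> //; [exact: ExecWhileStop | rewrite leq_addl].
have [t1 [s1 [e1 le1 [I1 lt1]]]] := body _ I bs.
have [t2 [s2 [e2 le2 q]]] := IH s1 I1 (leq_trans lt1 lt).
exists (t1 + t2).+1, s2; split=> //; first exact: ExecWhileLoop e1 e2.
by have : ((mu s1).+1 * T.+1 <= mu s * T.+1)%N; [rewrite leq_mul2r lt1 orbT|lia].
Qed.

(** [k] is the actual number of rounds, read from the input, and [L] a uniform bound that is charged
    instead. The stability hypothesis says that the invariant ignores the loop counter. *)
Lemma runs_for x y c (P : nat -> state R -> Prop) k T L s Q :
  imem s 0%N 0%N y = k -> (k <= L)%N ->
  0%N \notin x :: iwrites c -> x \notin iwrites c ->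
  (forall i s a, P i s -> P i (State (upd (imem s) x 0%N 0%N a) (vmem s))) ->
  P 0%N s ->
  (forall i s', (i < k)%N -> imem s' x 0%N 0%N = i -> keeps (For x y c) s s' ->
     P i s' -> runs c s' T (P i.+1)) ->
  (forall s', P k s' -> keeps (For x y c) s s' -> Q s') ->
  runs (For x y c) s (for_cost L T) Q.
Proof.
rewrite inE negb_or /for_cost => sk kL /andP[x0 c0] xc Pstable P0 body PQ.
rewrite addn2; apply: (@runs_weaken _ _ (1 + (k * T.+2 + 1))%N
  (fun s' => P k s')) => //; last first.
  by have : (k * T.+2 <= L * T.+2)%N; [rewrite leq_mul2r kL orbT|lia].
apply: runs_seq; apply: runs_seti => /=.
set s0 := State _ _.
pose Inv s' := exists i, [/\ (i <= k)%N, imem s' x 0%N 0%N = i,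
  keeps (For x y c) s s' & P i s'].
have kE s' : keeps (For x y c) s s' -> imem s' 0%N = imem s 0%N.
  by case=> H _; apply: H; rewrite /= inE mem_cat inE !negb_or x0 c0.
pose mu s' := (k - imem s' x 0%N 0%N)%N.
have mu0 : mu s0 = k by rewrite /mu /= /upd !eqxx subn0.
have H : runs (While (lt_ (reg x) (size_ y))
    (Seq c (set_reg x (IAdd (reg x) (IConst 1))))) s0 (mu s0 * T.+2 + 1)
    (fun s1 => Inv s1 /\ ~~ beval s1 (lt_ (reg x) (size_ y))).
  apply: (@runs_while _ _ Inv mu T.+1).
    exists 0%N; split=> //=.
    - by rewrite /upd !eqxx.
    - split=> z //=; rewrite !inE mem_cat => /norP[zx _]; exact: upd_other.
    - exact: Pstable.
  move=> s1 [i [ik s1i kp Pi]] /=; rewrite kE // sk s1i -ltnNge => lt.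
  rewrite -[T.+1]addn1.
  apply: runs_seq; have := body _ _ lt s1i kp Pi.
  move=> /runs_weaken; apply => // s2 P2 [kI kV]; apply: runs_seti => /=.
  have s2x : imem s2 x = imem s1 x by apply: kI.
  split; last first.
    by rewrite /mu /= /upd !eqxx s2x s1i /=; lia.
  exists i.+1; split=> //.
  - by rewrite /= /upd !eqxx s2x s1i addn1.
  - case: kp => kpI kpV; split=> z /=.
      rewrite inE mem_cat inE => /norP[zx /norP[zc _]].
      by rewrite upd_other // kI // kpI //= !inE mem_cat inE (negbTE zx) (negbTE zc).
    rewrite cats0 => zc; rewrite kV // kpV //= cats0 //.
  - exact: Pstable.
apply: runs_weaken H _ _; first by rewrite mu0.
move=> s1 [[i [ik s1i kp Pi]]] /=; rewrite kE // sk s1i negbK => ki _.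
by have -> : k = i by apply/eqP; rewrite eqn_leq ki.
Qed.

End Runs.

(** * The program *)

(* Integer arrays; the unallocated goods are owned by #|N|, and BEST = #|M|   *)
(* and SRC = #|N| stand for none.                                             *)
Notation OWN := 1%N (only parsing).
Notation RANK := 2%N (only parsing).
Notation PK := 3%N (only parsing).
Notation ENVIER := 4%N (only parsing).
Notation ROT := 5%N (only parsing).
Notation BASE := 6%N (only parsing).
Notation TIME := 7%N (only parsing).
Notation CUR := 8%N (only parsing).
Notation SRC := 9%N (only parsing).
Notation BEST := 10%N (only parsing).
Notation I_ := 11%N (only parsing).
Notation J_ := 12%N (only parsing).
Notation G_ := 13%N (only parsing).
Notation SHARE := 2%N (only parsing).

Notation agents := 0%N (only parsing).
Notation goods := 1%N (only parsing).

Definition value (g : iexp) : vexp := VGet 0 (IConst 0) g.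
Definition utility (i g : iexp) : vexp := VGet 1 i g.
Definition vlt (e1 e2 : vexp) : bexp := BNot (BLeV e2 e1).
Definition bor (b1 b2 : bexp) : bexp := BNot (BAnd (BNot b1) (BNot b2)).

Definition init_cmd : cmd :=
  For I_ goods
    (Seq (set_cell OWN (reg I_) (size_ agents))
    (Seq (set_cell RANK (reg I_) (IConst 0))
      (For J_ goods
        (If (bor (vlt (value (reg I_)) (value (reg J_)))
               (BAnd (BLeV (value (reg I_)) (value (reg J_)))
                  (lt_ (reg J_) (reg I_))))
          (set_cell RANK (reg I_) (IAdd (cell RANK (reg I_)) (IConst 1)))
          Skip)))).

Definition shares_cmd : cmd :=
  For I_ agents (For J_ agents
    (Seq (SetV SHARE (reg I_) (reg J_) VZero)
      (For G_ goods
        (If (eq_ (cell OWN (reg G_)) (reg J_))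
          (SetV SHARE (reg I_) (reg J_)
            (VAdd (VGet SHARE (reg I_) (reg J_)) (utility (reg I_) (reg G_))))
          Skip)))).

Definition free_ (e : iexp) : bexp := BLeI (cell PK e) (reg BASE).

Definition enviers_cmd : cmd :=
  Seq (set_reg SRC (size_ agents))
    (For J_ agents
      (Seq (set_cell ENVIER (reg J_) (size_ agents))
      (Seq (set_cell ROT (reg J_) (reg J_))
      (Seq
        (For I_ agents
          (If (BAnd (free_ (reg I_))
              (BAnd (free_ (reg J_))
                 (vlt (VGet SHARE (reg I_) (reg I_))
                      (VGet SHARE (reg I_) (reg J_)))))
             (set_cell ENVIER (reg J_) (reg I_))
             Skip))
        (If (free_ (reg J_))
          (Seq (set_reg CUR (reg J_))
            (If (ge_ (cell ENVIER (reg J_)) (size_ agents))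
              (set_reg SRC (reg J_)) Skip))
          Skip))))).

(** The first [#|N|] steps only bring [CUR] onto the cycle. The next ones go round it, possibly
    several times, which is harmless as [ENVIER] is fixed and the same entries are rewritten. *)
Definition rotate_cmd : cmd :=
  Seq (For I_ agents (set_reg CUR (cell ENVIER (reg CUR))))
  (Seq
    (For I_ agents
      (Seq (set_cell ROT (reg CUR) (cell ENVIER (reg CUR)))
           (set_reg CUR (cell ENVIER (reg CUR)))))
    (For G_ goods
      (If (lt_ (cell OWN (reg G_)) (size_ agents))
        (set_cell OWN (reg G_) (cell ROT (cell OWN (reg G_)))) Skip))).

Definition assign_test : bexp :=
  BAnd (BAnd (eq_ (cell OWN (reg G_)) (size_ agents))
         (lt_ (cell RANK (reg G_)) (IAdd (reg BASE) (size_ agents))))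
       (bor (eq_ (reg BEST) (size_ goods))
         (vlt (utility (reg SRC) (reg BEST)) (utility (reg SRC) (reg G_)))).

Definition assign_cmd : cmd :=
  Seq (set_reg BEST (size_ goods))
  (Seq
    (For G_ goods
      (If assign_test
        (set_reg BEST (reg G_)) Skip))
  (Seq (set_cell OWN (reg BEST) (reg SRC))
  (Seq (set_cell PK (reg SRC) (IAdd (reg TIME) (IConst 1)))
       (set_reg TIME (IAdd (reg TIME) (IConst 1)))))).

Definition next_block_cmd : cmd :=
  If (ge_ (reg TIME) (IAdd (reg BASE) (size_ agents)))
    (set_reg BASE (reg TIME)) Skip.

Definition step_cmd : cmd :=
  Seq shares_cmd
  (Seq enviers_cmd
    (If (lt_ (reg SRC) (size_ agents))
      (Seq assign_cmd next_block_cmd) rotate_cmd)).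

Definition allocate_cmd : cmd :=
  Seq init_cmd (While (lt_ (reg TIME) (size_ goods)) step_cmd).

Definition init_cost L := for_cost L (1 + (1 + for_cost L 2)).
Definition shares_cost L := for_cost L (for_cost L (1 + for_cost L 2)).
Definition enviers_cost L :=
  (1 + for_cost L (1 + (1 + (for_cost L 2 + (1 + 2).+1))))%N.
Definition rotate_cost L := (for_cost L 1 + (for_cost L (1 + 1) + for_cost L 2))%N.
Definition assign_cost L := (1 + (for_cost L 2 + (1 + (1 + 1))))%N.
(** Both branches of the test are charged: their sum bounds either one and stays polynomial. *)
Definition step_cost L :=
  (shares_cost L + (enviers_cost L + (assign_cost L + 2 + rotate_cost L).+1))%N.
Definition allocate_cost L :=
  (init_cost L + ((L * (L * L).+1 + L * L) * (step_cost L).+1 + 1))%N.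

(** * Correctness and running time of the subroutines *)

Section Program.
Variables (R : realType) (n m L : nat).
Hypothesis nL : (n <= L)%N.
Hypothesis mL : (m <= L)%N.
Implicit Type s : state R.

Definition sized s : Prop := imem s 0%N 0%N 0%N = n /\ imem s 0%N 0%N 1%N = m.
Definition arr s x : nat -> nat := fun i => imem s x i 0%N.

Lemma sized_keeps c s s' : 0%N \notin iwrites c -> keeps c s s' ->
  sized s -> sized s'.
Proof. by rewrite /sized => c0 [kI _]; rewrite kI. Qed.

Lemma big_ord_recr_cond (T : nmodType) k (P : pred nat) (F : nat -> T) :
  \sum_(i < k.+1 | P i) F i =
    \sum_(i < k | P i) F i + (if P k then F k else 0).
Proof. by rewrite big_mkcond big_ord_recr -big_mkcond. Qed.

Lemma upd_cell (T : Type) (mu : mem_of T) x i j a i' :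
  upd mu x i j a x i' j = if i' == i then a else mu x i' j.
Proof. by rewrite /upd !eqxx andbT. Qed.

Lemma runs_shares s : sized s ->
  runs shares_cmd s (shares_cost L) (fun s' => forall i j, (i < n)%N -> (j < n)%N ->
    vmem s' SHARE i j = share m (vmem s 1%N) (arr s OWN) i j).
Proof.
move=> sz; set sh := share _ _ _.
apply: (runs_for (P := fun k s' => forall i j, (i < k)%N -> (j < n)%N ->
  vmem s' SHARE i j = sh i j) sz.1) => //.
move=> i s1 ilt s1I kp1 P1.
have sz1 := sized_keeps (isT : 0%N \notin iwrites shares_cmd) kp1 sz.
apply: (runs_for (P := fun k s' =>
  (forall i' j, (i' < i)%N -> (j < n)%N -> vmem s' SHARE i' j = sh i' j) /\
  (forall j, (j < k)%N -> vmem s' SHARE i j = sh i j)) sz1.1) => //; last first.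
  move=> s' [Pi Pj] _ i' j; rewrite ltnS leq_eqVlt => /orP[/eqP ->|]; first exact: Pj.
  exact: Pi.
move=> j s2 jlt s2J kp2 [Pi Pj].
have s2I : imem s2 I_ 0%N 0%N = i by rewrite kp2.1.
have sz2 : sized s2 by apply: sized_keeps kp2 sz1.
apply: runs_seq; apply: runs_setv; rewrite /= s2I s2J; set s3 := State _ _.
apply: (runs_for (P := fun k s' =>
  (forall i' j', (i', j') != (i, j) -> vmem s' SHARE i' j' = vmem s2 SHARE i' j') /\
  vmem s' SHARE i j = \sum_(g < k | arr s OWN g == j) vmem s 1%N i g)
  (sz2.2 : imem s3 0%N 0%N 1%N = m)) => //.
- split; last by rewrite big_ord0 /= /upd !eqxx.
  move=> i' j'; rewrite /= /upd eqxx xpair_eqE => /negbTE /= ->; by [].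
- move=> g s4 glt s4G kp4 [Q1 Q2].
  have s4I : imem s4 I_ 0%N 0%N = i by rewrite kp4.1 // s2I.
  have s4J : imem s4 J_ 0%N 0%N = j by rewrite kp4.1 // s2J.
  have s4O : imem s4 OWN = imem s OWN.
    by rewrite kp4.1 //= kp2.1 //= kp1.1.
  have s4u : vmem s4 1%N = vmem s 1%N.
    by rewrite kp4.2 //= upd_other // kp2.2 //= kp1.2.
  apply: runs_if => /=; rewrite s4G s4J s4O -eqn_leq => e.
    apply: runs_setv; rewrite /= s4I s4J s4G s4u; split.
      move=> i' j' ne; rewrite /upd /= -Q1 //; move: ne; rewrite xpair_eqE.
      by move/negbTE => ->.
    by rewrite (big_ord_recr_cond _ (fun g => arr s OWN g == j)) /arr e -Q2 /upd /= !eqxx.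
  apply: runs_skip; split; first exact: Q1.
  by rewrite (big_ord_recr_cond _ (fun g => arr s OWN g == j)) /arr (negbTE e) addr0.
- move=> s' [Q1 Q2] _; split.
    move=> i' j' i'lt j'lt; rewrite Q1 ?Pi //.
    by apply: contraTneq i'lt => -[-> _]; rewrite ltnn.
  move=> j'; rewrite ltnS leq_eqVlt => /orP[/eqP -> //|j'lt].
  rewrite Q1 ?Pj //; by apply: contraTneq j'lt => -[->]; rewrite ltnn.
Qed.

Section Enviers.
Variable s : state R.
Let free i := (arr s PK i <= imem s BASE 0%N 0%N)%N.
Let envy i j := [&& free i, free j &
  vmem s SHARE i i < vmem s SHARE i j].

(** [CUR] is the starting point for the search of a cycle. It is guaranteed to be a waiting agent
    only if one exists, which [fair_partial_free] provides. *)
Lemma runs_enviers : sized s ->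
  runs enviers_cmd s (enviers_cost L) (fun s' =>
    let src := imem s' SRC 0%N 0%N in let c := imem s' CUR 0%N 0%N in
    let f := arr s' ENVIER in
    [/\ forall j, (j < n)%N -> arr s' ROT j = j,
        forall j, (j < n)%N -> free j -> (c < n)%N && free c &
        src = n /\
          (forall j, (j < n)%N -> free j -> (f j < n)%N && envy (f j) j) \/
        (src < n)%N /\ free src /\ (forall i, (i < n)%N -> ~~ envy i src)]).
Proof.
move=> sz; apply: runs_seq; apply: runs_seti; rewrite /= sz.1; set s0 := State _ _.
apply: (runs_for (P := fun k s' =>
    let src := imem s' SRC 0%N 0%N in let c := imem s' CUR 0%N 0%N in
    let f := arr s' ENVIER in
    [/\ forall j, (j < k)%N -> arr s' ROT j = j,
        forall j, (j < k)%N -> free j -> (c < n)%N && free c &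
        src = n /\
          (forall j, (j < k)%N -> free j -> (f j < n)%N && envy (f j) j) \/
        (src < n)%N /\ free src /\ (forall i, (i < n)%N -> ~~ envy i src)])
  (sz.1 : imem s0 0%N 0%N 0%N = n)) => //.
  by split=> //; left; split.
move=> j s1 jlt s1J kp1 [P1 P2 P3].
have [s1n _] : sized s1 by apply: sized_keeps kp1 _.
apply: runs_seq; apply: runs_seti; rewrite /= s1J s1n.
apply: runs_seq; apply: runs_seti; rewrite /= !upd_other // s1J; set s2 := State _ _.
apply: runs_seq.
apply: (runs_for (P := fun k s' =>
  (forall j', j' != j -> arr s' ENVIER j' = arr s1 ENVIER j') /\
  (arr s' ENVIER j = n /\ (forall i, (i < k)%N -> ~~ envy i j) \/
   (arr s' ENVIER j < n)%N /\ envy (arr s' ENVIER j) j))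
  (s1n : imem s2 0%N 0%N 0%N = n)) => //.
- split; last by left; split=> //; rewrite /arr /= /upd /= !eqxx.
  by move=> j' /negbTE ne; rewrite /arr /= /upd /= ne.
- move=> i s3 ilt s3I kp3 [Q1 Q2].
  have s3J : imem s3 J_ 0%N 0%N = j by rewrite kp3.1.
  have s3P : imem s3 PK = imem s PK.
    by rewrite kp3.1 //= /s2 /= !upd_other // kp1.1 //= upd_other.
  have s3B : imem s3 BASE = imem s BASE.
    by rewrite kp3.1 //= /s2 /= !upd_other // kp1.1 //= upd_other.
  have s3W : vmem s3 SHARE = vmem s SHARE by rewrite kp3.2 //= kp1.2.
  apply: runs_if => /=; rewrite s3I s3J s3P s3B s3W -ltNge -/(free i) -/(free j) => e.
    apply: runs_seti; rewrite /= s3I s3J; split.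
      by move=> j' ne; rewrite -Q1 // /arr /= /upd /= (negbTE ne).
    by right; rewrite /arr /= upd_cell eqxx; split.
  apply: runs_skip; split=> //; case: Q2 => [[Q2 Q3]|Q2]; last by right.
  left; split=> // i'; rewrite ltnS leq_eqVlt => /orP[/eqP -> //|]; exact: Q3.
move=> s3 [Q1 Q2] kp3.
have s3J : imem s3 J_ 0%N 0%N = j by rewrite kp3.1.
have s3n : imem s3 0%N 0%N 0%N = n by rewrite kp3.1.
have s3P : imem s3 PK = imem s PK.
  by rewrite kp3.1 //= /s2 /= !upd_other // kp1.1 //= upd_other.
have s3B : imem s3 BASE = imem s BASE.
  by rewrite kp3.1 //= /s2 /= !upd_other // kp1.1 //= upd_other.
have s3R j' : arr s3 ROT j' = if j' == j then j else arr s1 ROT j'.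
  by rewrite /arr kp3.1 //= /upd /= andbT.
have P1' : forall j', (j' < j.+1)%N -> arr s3 ROT j' = j'.
  move=> j'; rewrite s3R ltnS leq_eqVlt; case: eqP => [-> //|_]; exact: P1.
have s3C : imem s3 CUR = imem s1 CUR by rewrite kp3.1 //= !upd_other.
have s3S : imem s3 SRC = imem s1 SRC by rewrite kp3.1 //= !upd_other.
have P3f : (forall j', (j' < j)%N -> free j' ->
    (arr s1 ENVIER j' < n)%N && envy (arr s1 ENVIER j') j') ->
  (free j -> (arr s3 ENVIER j < n)%N && envy (arr s3 ENVIER j) j) ->
  forall j', (j' < j.+1)%N -> free j' ->
    (arr s3 ENVIER j' < n)%N && envy (arr s3 ENVIER j') j'.
  move=> H Hj j'; rewrite ltnS leq_eqVlt; case: eqVneq => [-> //|ne] /= lt.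
  by rewrite Q1 //; apply: H.
apply: runs_if => /=; rewrite s3J s3P s3B -/(free j) => fj; last first.
  apply: (@runs_weaken _ _ _ 1%N _ _ _ (runs_skip (Q := eq s3) erefl)) => // _ <- _.
  split=> //.
    move=> j'; rewrite ltnS leq_eqVlt s3C => /orP[/eqP ->|]; last exact: P2.
    by rewrite (negbTE fj).
  rewrite s3S; case: P3 => [[P3 P4]|P3]; last by right.
  by left; split=> //; apply: P3f => //; rewrite (negbTE fj).
apply: runs_seq; apply: runs_seti; rewrite /= s3J.
apply: runs_if => /=; rewrite upd_other // upd_other // upd_other // s3J s3n => e.
  apply: runs_seti => /=; rewrite (@upd_other _ _ _ _ _ _ J_) // s3J; split=> //.
    by move=> j' _ _; rewrite /upd /= jlt.
  right; rewrite /upd /=; split=> //; split=> //.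
  by case: Q2 => [[_ //]|[]]; rewrite ltnNge e.
apply: runs_skip; split=> //=.
  by move=> j' _ _; rewrite upd_cell /= jlt.
rewrite /= upd_other // s3S; case: P3 => [[P3 P4]|P3]; last by right.
left; split=> //; apply: P3f => // _.
case: Q2 => [[Q2 _]|[Q2 Q3]]; last by rewrite Q2.
by move: e; rewrite -/(arr s3 ENVIER j) Q2 leqnn.
Qed.

End Enviers.

Lemma runs_rotate s : sized s ->
  (forall i, (i < n)%N -> arr s ROT i = i) ->
  runs rotate_cmd s (rotate_cost L) (fun s' => forall g, (g < m)%N ->
    arr s' OWN g = if (arr s OWN g < n)%N
      then rotation n (arr s ENVIER) (imem s CUR 0%N 0%N) (arr s OWN g)
      else arr s OWN g).
Proof.
move=> sz rot0; set f := arr s ENVIER; set c0 := imem s CUR 0%N 0%N.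
apply: runs_seq.
apply: (runs_for (P := fun k s' => imem s' CUR 0%N 0%N = iter k f c0) sz.1) => //.
  move=> k s1 klt s1I kp1 P1; apply: runs_seti => /=.
  by rewrite upd_cell /= P1 kp1.1.
move=> s1 s1C kp1.
have sz1 : sized s1 by apply: sized_keeps kp1 sz.
apply: runs_seq.
set c := iter n f c0 in s1C *.
apply: (runs_for (P := fun k s' => imem s' CUR 0%N 0%N = iter k f c /\
  forall i, (i < n)%N -> arr s' ROT i = if i \in traject f c k then f i else i)
  sz1.1) => //.
- by split=> // i ilt; rewrite /arr kp1.1 //; apply: rot0.
- move=> k s2 klt s2I kp2 [Q1 Q2].
  have s2f : imem s2 ENVIER = imem s ENVIER by rewrite kp2.1 //= kp1.1.
  apply: runs_seq; apply: runs_seti; apply: runs_seti; split.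
    by rewrite /= upd_cell /= !upd_other // Q1 s2f.
  move=> i ilt; rewrite trajectSr mem_rcons inE /arr /= upd_other // upd_cell.
  by rewrite Q1 s2f; case: eqVneq => [-> //|_] /=; apply: Q2.
move=> s2 [_ s2R] kp2.
have sz2 : sized s2 by apply: sized_keeps kp2 sz1.
have s2O : imem s2 OWN = imem s OWN by rewrite kp2.1 //= kp1.1.
apply: (runs_for (P := fun k s' => forall g, arr s' OWN g =
    if (g < k)%N && (arr s OWN g < n)%N then rotation n f c0 (arr s OWN g)
    else arr s OWN g) sz2.2) => //.
- by move=> g; rewrite /arr s2O.
- move=> g s3 glt s3G kp3 P3.
  have s3n : imem s3 0%N 0%N 0%N = n by rewrite kp3.1 ?sz2.1.
  have s3O : imem s3 OWN g 0%N = arr s OWN g.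
    by have := P3 g; rewrite ltnn.
  have s3R : imem s3 ROT = imem s2 ROT by rewrite kp3.1.
  apply: runs_if => /=; rewrite s3G s3n s3O -ltnNge => e.
    apply: runs_seti; rewrite /= s3G s3O => g'; rewrite /arr /= upd_cell.
    case: eqVneq => [->|ne]; first by rewrite ltnSn e s3R -s2R.
    by rewrite ltnS leq_eqVlt (negbTE ne) -P3.
  apply: runs_skip => g'; rewrite P3 [in RHS]ltnS [in RHS]leq_eqVlt.
  by case: eqVneq => // ->; rewrite ltnn /= (negbTE e).
- by move=> s3 P3 _ g gm; rewrite P3 gm.
Qed.

Lemma runs_assign s (a := imem s SRC 0%N 0%N) (b := imem s BASE 0%N 0%N)
    (t := imem s TIME 0%N 0%N) (op := open n (arr s RANK) (arr s OWN) b) :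
  sized s -> (exists2 g, (g < m)%N & op g) ->
  runs assign_cmd s (assign_cost L) (fun s' => exists best,
    [/\ (best < m)%N, op best,
      (forall g, (g < m)%N -> op g -> vmem s 1%N a g <= vmem s 1%N a best),
      (forall g, arr s' OWN g = if g == best then a else arr s OWN g) &
      (forall i, arr s' PK i = if i == a then t.+1 else arr s PK i) /\
      imem s' TIME 0%N 0%N = t.+1]).
Proof.
move=> sz [g0 g0m g0op].
apply: runs_seq; apply: runs_seti; rewrite /= sz.2; apply: runs_seq.
set s1 := State _ _.
have sz1 : sized s1 by [].
apply: (runs_for (P := fun k s' => let best := imem s' BEST 0%N 0%N in
  best = m /\ (forall g, (g < k)%N -> ~~ op g) \/
  [/\ (best < m)%N, op best &
    forall g, (g < k)%N -> op g -> vmem s 1%N a g <= vmem s 1%N a best])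
  sz1.2) => //.
- by left.
- move=> g s2 glt s2G kp2 P2.
  have [s2n s2m] : sized s2 by apply: sized_keeps kp2 sz1.
  have s2O : imem s2 OWN = imem s OWN by rewrite kp2.1 //= upd_other.
  have s2K : imem s2 RANK = imem s RANK by rewrite kp2.1 //= upd_other.
  have s2B : imem s2 BASE = imem s BASE by rewrite kp2.1 //= upd_other.
  have s2S : imem s2 SRC = imem s SRC by rewrite kp2.1 //= upd_other.
  have s2u : vmem s2 1%N = vmem s 1%N by rewrite kp2.2.
  have testE : beval s2 assign_test = op g && ((imem s2 BEST 0%N 0%N == m) ||
      (vmem s 1%N a (imem s2 BEST 0%N 0%N) < vmem s 1%N a g)).
    rewrite /= s2G s2n s2m s2O s2K s2B s2S s2u -!eqn_leq -ltnNge -ltNge.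
    by rewrite negb_and !negbK.
  apply: runs_if; rewrite testE.
    case/andP => og best; apply: runs_seti; rewrite /= s2G upd_cell /=; right.
    split=> // g'; rewrite ltnS leq_eqVlt => /orP[/eqP -> //|lt og'].
    case: P2 => [[_ P2]|[bm _ P2]]; first by move: (P2 _ lt); rewrite og'.
    case/orP: best => [/eqP bE|/ltW]; first by rewrite bE ltnn in bm.
    by apply: le_trans; apply: P2.
  rewrite negb_and negb_or => H; apply: runs_skip.
  case: P2 => [[bE P2]|[bm bo P2]].
    left; split=> // g'; rewrite ltnS leq_eqVlt => /orP[/eqP ->|]; last exact: P2.
    by move: H; rewrite bE eqxx orbF.
  right; split=> // g'; rewrite ltnS leq_eqVlt => /orP[/eqP ->|]; last exact: P2.
  by move=> og; move: H; rewrite og /= -leNgt => /andP[].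
move=> s2 P2 kp2.
have s2O : imem s2 OWN = imem s OWN by rewrite kp2.1 //= upd_other.
have s2P : imem s2 PK = imem s PK by rewrite kp2.1 //= upd_other.
have s2T : imem s2 TIME = imem s TIME by rewrite kp2.1 //= upd_other.
have s2S : imem s2 SRC = imem s SRC by rewrite kp2.1 //= upd_other.
apply: runs_seq; apply: runs_seti; apply: runs_seq; apply: runs_seti.
apply: runs_seti => /=.
case: P2 => [[_ P2]|[bm bo P2]]; first by move: (P2 _ g0m); rewrite g0op.
exists (imem s2 BEST 0%N 0%N); split=> //.
  by move=> g; rewrite /arr /= /upd /= andbT s2S s2O.
split; last by rewrite /upd /= s2T addn1.
by move=> i; rewrite /arr /= /upd /= andbT s2S s2P s2T addn1.
Qed.

Lemma runs_init s : sized s ->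
  runs init_cmd s (init_cost L) (fun s' => forall g, (g < m)%N ->
    arr s' OWN g = n /\ arr s' RANK g = rank m (vmem s 0%N 0%N) g).
Proof.
move=> sz; set v := vmem s 0%N 0%N.
apply: (runs_for (P := fun k s' => forall g, (g < k)%N ->
    arr s' OWN g = n /\ arr s' RANK g = rank m v g) sz.2) => //.
move=> g s1 glt s1I kp1 P1.
have sz1 : sized s1 by apply: sized_keeps kp1 sz.
apply: runs_seq; apply: runs_seti; apply: runs_seq; apply: runs_seti.
rewrite /= upd_other // s1I sz1.1; set s2 := State _ _.
apply: (runs_for (P := fun k s' =>
  arr s' RANK g = (\sum_(j < k) before v j g)%N /\
  forall g', g' != g -> arr s' RANK g' = arr s1 RANK g')
  (sz1.2 : imem s2 0%N 0%N 1%N = m)) => //.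
- split=> [|g' /negbTE ne]; rewrite /arr /= upd_cell ?eqxx ?big_ord0 //.
  by rewrite ne.
- move=> j s3 jlt s3J kp3 [Q1 Q2].
  have s3I : imem s3 I_ 0%N 0%N = g by rewrite kp3.1 //= !upd_other.
  have s3v : vmem s3 0%N 0%N = v by rewrite kp3.2 //= kp1.2.
  apply: runs_if => /=; rewrite s3I s3J s3v negb_and !negbK -[X in X || _]/(~~ _)
     -ltnNge -/(before v j g) => e.
    apply: runs_seti; rewrite /= s3I; split.
      by rewrite /arr /= upd_cell eqxx big_ord_recr /= e -Q1.
    by move=> g' ne; rewrite /arr /= upd_cell (negbTE ne); exact: Q2.
  by apply: runs_skip; split=> //; rewrite big_ord_recr /= (negbTE e) addn0.
move=> s3 [Q1 Q2] kp3 g'; rewrite ltnS leq_eqVlt => /orP[/eqP ->|lt].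
  by split=> //; rewrite /arr kp3.1 //= upd_other // upd_cell eqxx.
have ne : g' != g by rewrite neq_ltn lt.
rewrite Q2 // -(P1 _ lt).2; split=> //.
by rewrite /arr kp3.1 //= upd_other // upd_cell (negbTE ne); case: (P1 _ lt).
Qed.

End Program.

(** * One round of the main loop *)

Section Allocate.
Variables (R : realType) (n m L : nat) (u : nat -> nat -> R) (rk : nat -> nat).
Hypothesis nL : (n <= L)%N.
Hypothesis mL : (m <= L)%N.
Hypothesis n_gt0 : (0 < n)%N.
Hypothesis u_ge0 : forall i g, 0 <= u i g.
Hypothesis rk_ltm : forall g, (g < m)%N -> (rk g < m)%N.
Hypothesis rk_inj :
  forall g g', (g < m)%N -> (g' < m)%N -> rk g = rk g' -> g = g'.
Implicit Type s : state R.

Notation base s := (imem s BASE 0%N 0%N).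
Notation time s := (imem s TIME 0%N 0%N).

(** The loop invariant; its last clause says that the current block is not finished, so some agent
    is still waiting. *)
Definition allocating s : Prop :=
  [/\ sized n m s, vmem s 1%N = u, arr s RANK = rk,
      fair_partial n m u rk (arr s OWN) (arr s PK) (base s) (time s)
    & (time s < base s + n)%N].

Definition work_left s : nat :=
  ((m - time s) * (n * n).+1 +
   envy_count n m u (arr s OWN) (arr s PK) (base s))%N.

Lemma runs_step s : allocating s -> (time s < m)%N ->
  runs step_cmd s (step_cost L)
    (fun s' => allocating s' /\ (work_left s' < work_left s)%N).
Proof.
move=> [sz su sr fp tb] tm.
set own := arr s OWN in fp; set pk := arr s PK in fp; set b := base s in fp tb.
set t := time s in fp tb tm.
apply: runs_seq; apply: runs_weaken (runs_shares nL mL sz) (leqnn _) _.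
move=> s1 s1W kp1; rewrite su -/own in s1W.
have sz1 : sized n m s1 by apply: sized_keeps kp1 sz.
apply: runs_seq; apply: runs_weaken (runs_enviers nL sz1) (leqnn _) _.
move=> s2; set src := imem s2 SRC 0%N 0%N; set c := imem s2 CUR 0%N 0%N.
set f := arr s2 ENVIER => H kp2.
have sz2 : sized n m s2 by apply: sized_keeps kp2 sz1.
have s1P : arr s1 PK = pk by rewrite /arr kp1.1.
have s1B : imem s1 BASE 0%N 0%N = b by rewrite kp1.1.
have {H} [s2R cfree H] : [/\ forall j, (j < n)%N -> arr s2 ROT j = j,
    forall j, (j < n)%N -> (pk j <= b)%N -> (c < n)%N && (pk c <= b)%N &
    src = n /\
      (forall j, (j < n)%N -> (pk j <= b)%N ->
        (f j < n)%N && envies m u own pk b (f j) j) \/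
    (src < n)%N /\ (pk src <= b)%N /\
      (forall i, (i < n)%N -> ~~ envies m u own pk b i src)].
  move: H; rewrite s1P s1B => -[H1 H2 H3]; split=> //.
  case: H3 => [[-> H3]|[sn [sf H3]]]; [left|right]; split=> //.
    move=> j jn jf; have /andP[fn] := H3 j jn jf.
    by rewrite fn /envies !s1W.
  by split=> // i ilt; have := H3 i ilt; rewrite /envies !s1W.
have s2O : imem s2 OWN = imem s OWN by rewrite kp2.1 //= kp1.1.
have s2P : imem s2 PK = imem s PK by rewrite kp2.1 //= kp1.1.
have s2K : imem s2 RANK = imem s RANK by rewrite kp2.1 //= kp1.1.
have s2B : imem s2 BASE = imem s BASE by rewrite kp2.1 //= kp1.1.
have s2T : imem s2 TIME = imem s TIME by rewrite kp2.1 //= kp1.1.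
have s2u : vmem s2 1%N = u by rewrite kp2.2 //= kp1.2.
apply: runs_if => /=; rewrite sz2.1 -/src -ltnNge => e.
  case: H => [[srcn _]|[_ [sfree unenvied]]]; first by rewrite srcn ltnn in e.
  apply: runs_leq (leq_addr _ _) _.
  apply: runs_seq.
  have op : exists2 g, (g < m)%N & open n (arr s2 RANK) (arr s2 OWN) (base s2) g.
    rewrite /arr s2K s2O s2B -/(arr s RANK) sr.
    by have := fair_partial_open rk_ltm rk_inj fp tb tm.
  apply: runs_weaken (runs_assign mL sz2 op) (leqnn _) _ => s3.
  rewrite /arr s2K s2O s2P s2B s2T s2u -/(arr s RANK) sr -/src.
  move=> [best [bm bo bmax s3O [s3P s3T]]] kp3.
  have fp3 := fair_partial_assign u_ge0 fp tb e sfree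
    unenvied bm bo bmax s3O s3P.
  have sz3 : sized n m s3 by apply: sized_keeps kp3 sz2.
  have s3K : arr s3 RANK = rk by rewrite /arr kp3.1 //= s2K.
  have s3u : vmem s3 1%N = u by rewrite kp3.2.
  have s3B : imem s3 BASE = imem s BASE by rewrite kp3.1.
  have wl s4 : time s4 = t.+1 -> (work_left s4 < work_left s)%N.
    move=> s4T; rewrite /work_left s4T -/t.
    have := envy_count_le n m u (arr s4 OWN) (arr s4 PK) (base s4).
    set x := envy_count _ _ _ _ _ _; set y := envy_count _ _ _ _ _ _ => xle.
    have -> : (m - t = (m - t.+1).+1)%N by lia.
    rewrite mulSn; lia.
  apply: runs_if => /=; rewrite sz3.1 s3T s3B -/b => eb.
    apply: runs_seti; rewrite /= s3T; set s4 := State _ _.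
    have s4B : base s4 = t.+1 by rewrite /= upd_cell.
    have s4T : time s4 = t.+1 by rewrite /= upd_other.
    split; last exact: wl.
    split=> //; rewrite s4T s4B; last by rewrite -addn1 leq_add2l.
    apply: (fair_partial_next_block rk_ltm rk_inj fp3).
    by apply/eqP; rewrite eqn_leq eb andbT.
  apply: runs_skip; split; last exact: wl.
  by split=> //; rewrite ?s3T ?s3B // ltnNge.
case: H => [[srcn fenv]|[srclt _]]; last by rewrite srclt in e.
apply: runs_leq (leq_addl _ _) _.
apply: runs_weaken (runs_rotate nL mL sz2 s2R) (leqnn _) _ => s3 s3O kp3.
(* The existence of a waiting agent makes [c] one too, so the walk along enviers can start there. *)
have [i0 i0n i0f] := fair_partial_free n_gt0 fp tb.
pose P i := (pk i <= b)%N.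
have f_lt i : (i < n)%N -> P i -> (f i < n)%N && P (f i).
  by move=> iltn Pi; have /and3P[-> + _] := fenv i iltn Pi.
have c_lt : (c < n)%N && P c := cfree _ i0n i0f.
pose h := rotation n f c.
have h_lt i : (i < n)%N -> (h i < n)%N by apply: rotation_lt f_lt c_lt _.
have h_inj i j : (i < n)%N -> (j < n)%N -> h i = h j -> i = j.
  by move=> _ _; apply: rotation_inj f_lt c_lt _ _.
have h_free i : (i < n)%N -> (b < pk (h i))%N = (b < pk i)%N.
  by move=> _; have := rotation_free f_lt c_lt i; rewrite /P -/h; lia.
have h_improves i : (i < n)%N -> share m u own (h i) (h i) <= share m u own (h i) i.
  rewrite /h /rotation; case: ifP => // it _.
  have /andP[iltn Pi] := traject_lt f_lt c_lt it.
  by have /and4P[_ _ _ /ltW] := fenv i iltn Pi.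
have ownE g : (g < m)%N -> arr s3 OWN g = if (own g < n)%N then h (own g) else own g.
  by move=> gm; rewrite s3O // /arr s2O.
have s3P : imem s3 PK = imem s PK by rewrite kp3.1.
have s3B : imem s3 BASE = imem s BASE by rewrite kp3.1.
have s3T : imem s3 TIME = imem s TIME by rewrite kp3.1.
have [cn Pc hc] := rotation_moves f_lt c_lt.
split.
  split; [by apply: sized_keeps kp3 sz2| by rewrite kp3.2 | | | ].
  - by rewrite /arr kp3.1 //= s2K.
  - rewrite /arr s3P s3B s3T.
    exact: (fair_partial_rotate h_lt h_inj ownE h_free h_improves fp).
  - by rewrite s3B s3T.
rewrite /work_left s3T s3B ltn_add2l /arr s3P.
apply: (envy_count_rotate h_lt h_inj ownE h_free h_improves cn).
by rewrite [h _]hc; have /andP[] := fenv _ cn Pc.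
Qed.

End Allocate.

Lemma runs_allocate (R : realType) (n m L : nat) (s : state R) :
  (n <= L)%N -> (m <= L)%N -> (0 < n)%N -> sized n m s ->
  (forall i g, 0 <= vmem s 1%N i g) ->
  (forall i, arr s PK i = 0%N) ->
  imem s BASE 0%N 0%N = 0%N -> imem s TIME 0%N 0%N = 0%N ->
  runs allocate_cmd s (allocate_cost L) (fun s' =>
    (forall g, (g < m)%N -> arr s' RANK g = rank m (vmem s 0%N 0%N) g) /\
    exists pk b, fair_partial n m (vmem s 1%N) (arr s' RANK) (arr s' OWN) pk b m).
Proof.
move=> nL mL n0 sz u0 pk0 b0 t0; set v := vmem s 0%N 0%N; set u := vmem s 1%N.
apply: runs_seq; apply: runs_weaken (runs_init mL sz) (leqnn _) _ => s1 s1E kp1.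
set rk := arr s1 RANK.
have rkE g : (g < m)%N -> rk g = rank m v g by move=> /s1E[].
have rk_ltm g : (g < m)%N -> (rk g < m)%N.
  by move=> gm; rewrite rkE //; apply: rank_ltm.
have rk_inj g g' : (g < m)%N -> (g' < m)%N -> rk g = rk g' -> g = g'.
  by move=> gm gm'; rewrite !rkE //; apply: rank_inj.
have s1B : imem s1 BASE 0%N 0%N = 0%N by rewrite kp1.1.
have s1T : imem s1 TIME 0%N 0%N = 0%N by rewrite kp1.1.
have al1 : allocating n m u rk s1.
  split; rewrite ?s1B ?s1T //; first by apply: sized_keeps kp1 sz.
  - by rewrite kp1.2.
  - apply: fair_partial_init => [g /s1E[] //|i].
    by rewrite /arr kp1.1 //; apply: pk0.
apply: (runs_weaken (T := (work_left n m u s1 * (step_cost L).+1 + 1))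
  (Q := fun s' => allocating n m u rk s' /\ ~~ beval s' (lt_ (reg TIME) (size_ goods)))).
- apply: runs_while => // s2 al2; have [sz2 _ _ _ _] := al2.
  by rewrite /= sz2.2 -ltnNge => /(runs_step nL mL n0 u0 rk_ltm rk_inj al2).
- rewrite leq_add2r leq_mul2r /= /work_left s1T subn0; apply: leq_add.
    by apply: leq_mul => //; rewrite ltnS leq_mul.
  by apply: leq_trans (envy_count_le _ _ _ _ _ _) _; rewrite leq_mul.
move=> s2 [[sz2 s2u s2r fp _]] /=; rewrite sz2.2 negbK => mt _.
rewrite s2r; split=> //; exists (arr s2 PK), (imem s2 BASE 0%N 0%N).
have tm := fair_partial_le fp; move: fp.
by have -> : imem s2 TIME 0%N 0%N = m by apply/eqP; rewrite eqn_leq tm.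
Qed.

(** * From numbers to agents and goods *)

Definition polynomial_fun (f : nat -> nat) : Prop :=
  exists q : {poly nat}, forall x, q.[x] = f x.

Lemma polynomial_id : polynomial_fun id.
Proof. by exists 'X => x; rewrite hornerX. Qed.

Lemma polynomial_const k : polynomial_fun (fun=> k).
Proof. by exists k%:P => x; rewrite hornerC. Qed.

Lemma polynomial_add f g : polynomial_fun f -> polynomial_fun g ->
  polynomial_fun (fun x => f x + g x)%N.
Proof. by move=> [p pE] [q qE]; exists (p + q) => x; rewrite hornerD pE qE. Qed.

Lemma polynomial_mul f g : polynomial_fun f -> polynomial_fun g ->
  polynomial_fun (fun x => f x * g x)%N.
Proof. by move=> [p pE] [q qE]; exists (p * q) => x; rewrite hornerM pE qE. Qed.

Lemma polynomial_succ f : polynomial_fun f -> polynomial_fun (fun x => (f x).+1).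
Proof. by move/(polynomial_add (polynomial_const 1)). Qed.

Lemma polynomial_for f :
  polynomial_fun f -> polynomial_fun (fun x => for_cost x (f x)).
Proof.
move=> pf; apply: polynomial_add (polynomial_const 2).
by apply: polynomial_mul polynomial_id _; do 2!apply: polynomial_succ.
Qed.

Lemma polynomial_allocate_cost : polynomial_fun allocate_cost.
Proof.
rewrite /allocate_cost /step_cost /init_cost /shares_cost /enviers_cost.
rewrite /assign_cost /rotate_cost.
repeat first [exact: polynomial_id | exact: polynomial_const
  | apply: polynomial_for | apply: polynomial_succ | apply: polynomial_add
  | apply: polynomial_mul].
Qed.

Section Transfer.
Variables (R : realType) (N M : finType).
Variables (v : {set M} -> R) (u : N -> {set M} -> R).
Hypothesis inst : fair_division_instance v u.
Variables (rk own pk : nat -> nat) (b : nat).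

Let uu := input_vmem v u 1%N.
Let vv := input_vmem v u 0%N 0%N.

Hypothesis rkE : forall g, (g < #|M|)%N -> rk g = rank #|M| vv g.
Hypothesis fp : fair_partial #|N| #|M| uu rk own pk b #|M|.

Let A : {ffun N -> {set M}} :=
  [ffun i => [set g | own (enum_rank g) == enum_rank i :> nat]].

Lemma input_marketE g : vv (enum_rank g) = v [set g].
Proof. by rewrite /vv /= (nth_map g) -?cardE // nth_enum_rank. Qed.

Lemma input_utilityE i g : uu (enum_rank i) (enum_rank g) = u i [set g].
Proof.
rewrite /uu /= (nth_map i) -?cardE // nth_enum_rank.
by rewrite (nth_map g) -?cardE // nth_enum_rank.
Qed.

(** All indices are covered, including those outside the table, where the default 0 is read. *)
Lemma input_utility_ge0 i g : 0 <= uu i g.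
Proof.
have [_ _ u_ok] := inst; rewrite /uu /=.
set row := nth [::] _ _; have: all (fun x => 0 <= x) row.
  rewrite /row; case: (ltnP i #|N|) => iN; last first.
    by rewrite nth_default // size_map -cardE.
  rewrite (nth_map (enum_val (Ordinal iN))) -?cardE //.
  set a := nth _ (enum N) i.
  by apply/allP => _ /mapP[h _ ->]; case: (u_ok a).
case: (ltnP g (size row)) => [lt /allP|ge _]; last by rewrite nth_default.
by apply; apply: mem_nth.
Qed.

Lemma additive_setD1 (f : {set M} -> R) (S : {set M}) g : additive_setfun f ->
  g \in S -> f (S :\ g) = f S - f [set g].
Proof.
by move=> add gS; rewrite (add (S :\ g)) (add S) (big_setD1 g gS) /= addrAC subrr add0r.
Qed.

Lemma bundle_value i j : u i (A j) = share #|M| uu own (enum_rank i) (enum_rank j).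
Proof.
have [_ _ u_ok] := inst; have [_ u_add] := u_ok i.
rewrite u_add /share (reindex (@enum_rank M)) /=; last exact/onW_bij/enum_rank_bij.
by apply: eq_big => g; rewrite ?ffunE ?inE // input_utilityE.
Qed.

Lemma transfer_allocation : is_allocation A.
Proof.
split=> [i j ij|].
  apply/pred0P => g; rewrite !inE !ffunE !inE; apply/negP => /andP[/eqP -> /eqP].
  by move/val_inj/enum_rank_inj/eqP; rewrite (negbTE ij).
apply/setP => g; rewrite !inE; apply/bigcupP.
have lt : (own (enum_rank g) < #|N|)%N.
  have : [set g : 'I_#|M| | (own g < #|N|)%N] == [set: 'I_#|M|].
    by rewrite eqEcard subsetT cardsT card_ord (fp_count fp) /=.
  by move/eqP/setP/(_ (enum_rank g)); rewrite !inE.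
exists (enum_val (Ordinal lt)) => //.
by rewrite ffunE inE enum_valK.
Qed.

Lemma transfer_EF1 : EF1 u A.
Proof.
have [_ _ u_ok] := inst.
move=> i j; have [u_ge0 u_add] := u_ok i.
have [->|[g0 g0A]] := set_0Vmem (A j); [by left|right].
case: (fp_ef1 fp (ltn_ord (enum_rank i)) (ltn_ord (enum_rank j))).
  rewrite -!bundle_value => le; exists g0 => //.
  by rewrite additive_setD1 //; apply: le_trans le; rewrite gerBl.
case=> g [gm gj le]; pose h := enum_val (Ordinal gm).
have hg : enum_rank h = Ordinal gm by rewrite enum_valK.
have hA : h \in A j by rewrite ffunE inE hg /= gj.
exists h => //; rewrite additive_setD1 // !bundle_value -input_utilityE hg.
exact: le.
Qed.

Lemma transfer_SD_EF1 : SD_EF1 v A.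
Proof.
move=> i j; have [->|[g0 g0A]] := set_0Vmem (A j); [by left|right].
(* The removed good is the best-ranked one of [A j], chosen before the threshold [g]. If a segment
   contains it, the removal compensates the possible excess of one; otherwise the segment contains
   no good of [A j]. *)
case: (arg_minnP (fun g => rk (enum_rank g)) g0A) => g1 g1m g1min.
have {g1m} g1A : g1 \in A j := g1m.
exists g1 => // g.
set S := [set h : 'I_#|M| | vv (enum_rank g) <= vv h].
have segE (g' : M) : (v [set g] <= v [set g']) = (rk (enum_rank g') < #|S|)%N.
  by rewrite rkE // -rank_segment inE !input_marketE.
have cntE k : #|[set g' in A k | v [set g] <= v [set g']]| =
    held #|M| rk own (enum_rank k) #|S|.
  rewrite /held -(on_card_preimset (f := @enum_rank M)); last exact/onW_bij/enum_rank_bij.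
  by apply: eq_card => g'; rewrite !inE ffunE inE segE.
rewrite cntE; have := fp_sd fp #|S| (ltn_ord (enum_rank j)) (ltn_ord (enum_rank i)).
rewrite -cntE (cardsD1 g1 [set g' in A j | _]) inE g1A /= segE.
have [lt|ge] := ltnP (rk (enum_rank g1)) #|S|; rewrite ?add0n ?add1n ?ltnS.
  apply: leq_trans; apply/subset_leq_card/subsetP => g'.
  by rewrite !inE => /andP[/andP[-> ->] ->].
move=> _; rewrite (_ : [set _ in _ | _] = set0) ?cards0 //.
apply/setP => g'; rewrite !inE segE.
case: (boolP (g' \in A j)) => [g'A|_]; last by rewrite andbF.
by rewrite ltnNge (leq_trans ge (g1min _ g'A)) andbF.
Qed.

End Transfer.

Theorem corollary1 (R : realType) :
  (forall (N M : finType) (v : {set M} -> R) (u : N -> {set M} -> R),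
     fair_division_instance v u ->
     exists A : {ffun N -> {set M}},
       [/\ is_allocation A, EF1 u A & SD_EF1 v A])
  /\
  (exists (p : cmd) (q : {poly nat}),
     forall (N M : finType) (v : {set M} -> R) (u : N -> {set M} -> R),
     fair_division_instance v u ->
     exists (t : nat) (s : state R) (A : {ffun N -> {set M}}),
       [/\ exec p (input_state v u) t s,
           (t <= q.[#|N| + #|M|]%R)%N,
           outputs s A
         & [/\ is_allocation A, EF1 u A & SD_EF1 v A]]).
Proof.
(* Existence is read off from the output of the program. *)
suff main : exists (p : cmd) (q : {poly nat}),
     forall (N M : finType) (v : {set M} -> R) (u : N -> {set M} -> R),
     fair_division_instance v u ->
     exists (t : nat) (s : state R) (A : {ffun N -> {set M}}),
       [/\ exec p (input_state v u) t s,
           (t <= q.[#|N| + #|M|]%R)%N,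
           outputs s A
         & [/\ is_allocation A, EF1 u A & SD_EF1 v A]].
  split=> // N M v u inst; have [p [q H]] := main.
  by have [_ [_ [A [_ _ _ ?]]]] := H N M v u inst; exists A.
have [q qE] := polynomial_allocate_cost.
exists allocate_cmd, q => N M v u inst; rewrite qE.
have [N0 _ _] := inst.
have [t [s [ex le [rkE [pk [b fp]]]]]] := @runs_allocate R #|N| #|M|
  (#|N| + #|M|) (input_state v u) (leq_addr _ _) (leq_addl _ _) N0
  (conj erefl erefl) (input_utility_ge0 inst) (fun=> erefl) erefl erefl.
exists t, s, [ffun i : N =>
  [set g : M | arr s OWN (enum_rank g) == enum_rank i :> nat]].
split; [exact: ex | exact: le | | split].
- by move=> i g; rewrite ffunE inE.
- exact: transfer_allocation fp.
- exact: (transfer_EF1 inst fp).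
- exact: transfer_SD_EF1 rkE fp.
Qed.
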